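(* Let $F$ be a distribution on $[0,\infty)$, $\mu>0$, and let $G=e^{-\mu}\sum_{n\ge0}\frac{\mu^n}{n!}F^{*n}$ be the corresponding compound Poisson distribution. Let $0<T\le\infty$, $\Delta=(0,T]$, and if $T<\infty$ assume $F\in\mathcal L_\Delta$. Then $F\in\mathcal S_\Delta$ if and only if $G(x+\Delta)\sim\mu F(x+\Delta)$ as $x\to\infty$.
   Context: $F^{*0}$ is the unit mass at $0$, $F^{*n}$ the $n$-fold convolution. For $0<T\le\infty$, $x+\Delta=(x,x+T]$. $F\in\mathcal L_\Delta$ means $F(x+\Delta)>0$ for all large $x$ and $F(x+t+\Delta)/F(x+\Delta)\to1$ as $x\to\infty$ uniformly in $t\in[0,1]$. A distribution $F$ on $[0,\infty)$ with unbounded support is in $\mathcal S_\Delta$ if $F\in\mathcal L_\Delta$ and $(F*F)(x+\Delta)\sim2F(x+\Delta)$. $a\sim b$ means $a/b\to1$. *)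

(* Defs.v *)
From Stdlib Require Import Reals Factorial List ClassicalEpsilon.
Open Scope R_scope.

Inductive borel : (R -> Prop) -> Prop :=
| borel_Ioc (a b : R) : borel (fun x => a < x <= b)
| borel_compl (A : R -> Prop) : borel A -> borel (fun x => ~ A x)
| borel_union (A : nat -> R -> Prop) :
    (forall n, borel (A n)) -> borel (fun x => exists n, A n x).

(** A distribution on [0,oo): a probability measure on the Borel sets of R
    (values on non-Borel sets are irrelevant) giving mass 0 to (-oo,0). *)
Definition distribution_nonneg (P : (R -> Prop) -> R) : Prop :=
  (forall A, borel A -> 0 <= P A) /\
  P (fun _ => True) = 1 /\
  (forall A : nat -> R -> Prop,
      (forall n, borel (A n)) ->
      (forall m n x, m <> n -> A m x -> A n x -> False) ->
      infinite_sum (fun n => P (A n)) (P (fun x => exists n, A n x))) /\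
  P (fun x => x < 0) = 0.

Definition Rsup (E : R -> Prop) : R :=
  match excluded_middle_informative (exists l, is_lub E l) with
  | left H => proj1_sig (constructive_indefinite_description _ H)
  | right _ => 0
  end.

Definition series_sum (a : nat -> R) : R :=
  match excluded_middle_informative (exists l, infinite_sum a l) with
  | left H => proj1_sig (constructive_indefinite_description _ H)
  | right _ => 0
  end.

Definition indic (A : R -> Prop) (x : R) : R :=
  if excluded_middle_informative (A x) then 1 else 0.

Definition simple_eval (s : list (R * (R -> Prop))) (x : R) : R :=
  fold_right (fun p acc => fst p * indic (snd p) x + acc) 0 s.

Definition simple_int (P : (R -> Prop) -> R) (s : list (R * (R -> Prop))) : R :=
  fold_right (fun p acc => fst p * P (snd p) + acc) 0 s.

Definition integral (P : (R -> Prop) -> R) (f : R -> R) : R :=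
  Rsup (fun v => exists s : list (R * (R -> Prop)),
          Forall (fun p => 0 <= fst p /\ borel (snd p)) s /\
          (forall x, simple_eval s x <= f x) /\
          v = simple_int P s).

Definition conv (P Q : (R -> Prop) -> R) (A : R -> Prop) : R :=
  integral P (fun y => Q (fun z => A (z + y))).

Definition dirac0 (A : R -> Prop) : R := indic A 0.

Fixpoint convpow (P : (R -> Prop) -> R) (n : nat) : (R -> Prop) -> R :=
  match n with
  | O => dirac0
  | S m => conv (convpow P m) P
  end.

Definition cpoisson (mu : R) (P : (R -> Prop) -> R) (A : R -> Prop) : R :=
  series_sum (fun n => exp (- mu) * (mu ^ n / INR (Factorial.fact n)) * convpow P n A).

(** T in (0, oo]: [Some t] is finite t, [None] is oo. x + Delta = (x, x+T]. *)
Definition ival (x : R) (T : option R) : R -> Prop :=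
  match T with
  | Some t => fun y => x < y <= x + t
  | None => fun y => x < y
  end.

Definition T_pos (T : option R) : Prop :=
  match T with Some t => 0 < t | None => True end.

Definition asymp_equiv (a b : R -> R) : Prop :=
  forall eps, 0 < eps -> exists x0, forall x, x0 <= x ->
    b x <> 0 /\ Rabs (a x / b x - 1) < eps.

Definition in_L (P : (R -> Prop) -> R) (T : option R) : Prop :=
  (exists x0, forall x, x0 <= x -> 0 < P (ival x T)) /\
  (forall eps, 0 < eps -> exists x0, forall x t, x0 <= x -> 0 <= t <= 1 ->
     Rabs (P (ival (x + t) T) / P (ival x T) - 1) < eps).

Definition unbounded_support (P : (R -> Prop) -> R) : Prop :=
  forall a, 0 < P (fun y => a < y).

Definition in_S (P : (R -> Prop) -> R) (T : option R) : Prop :=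
  unbounded_support P /\ in_L P T /\
  asymp_equiv (fun x => conv P P (ival x T)) (fun x => 2 * P (ival x T)).

(* Main.v *)
Require Import Defs.
From Stdlib Require Import Reals List ClassicalEpsilon Lra Lia.
From HB Require Import structures.
From mathcomp Require Import all_boot all_order all_algebra.
From mathcomp Require Import all_classical all_reals all_analysis.
From mathcomp Require Import measurable_realfun Rstruct Rstruct_topology.
(* MathComp-Analysis also defines [indic] and [integral]; those of [Defs] must win. *)
Import Order.TTheory GRing.Theory Num.Theory Defs.
Open Scope R_scope.

(** Write f(x) = F(x+Delta), f_n(x) = F^{*n}(x+Delta), p_n = e^{-mu} mu^n/n!, and
    split X_1 + ... + X_{n+1} in x+Delta according to the size of the last summand.

    Whenever f(x-y) >= (1-o(1)) f(x) locally uniformly in y, the two disjoint events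
    {X_{n+1} <= a} and {X_1 + ... + X_n <= a} give liminf f_n/f >= n by induction.

    If F is in S_Delta, then x+Delta is reached either with X_{n+1} > x-a, which
    contributes at most (1+o(1)) f(x), or with X_1 + ... + X_n of size at least about
    a, where f_n can be compared with n f (or with K^n f) and the mass
    f_2(x) - (1-o(1)) f(x) of two such summands is what remains. Hence
    limsup f_n/f <= n and f_n <= K^n f, and dominated convergence yields
    G(x+Delta)/f(x) -> sum n p_n = mu.

    Conversely, if G(x+Delta) ~ mu f(x) = sum n p_n f(x), the lower bounds
    liminf f_n/f >= n leave no room for limsup f_2/f > 2. When T is infinite the
    regularity needed for the lower bound is monotonicity of the tail, and F in
    L_Delta is then recovered from f_2 ~ 2f.

    Measures are transported to MathComp-Analysis, where F^{*n} is the law of a sum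
    under a product measure and Fubini's theorem is available. *)

Local Notation realR := (R : realType).

(** * Product probability measures *)

Section product_probability.
Local Open Scope classical_set_scope.
Local Open Scope ereal_scope.
Context {R : realType} (P Q : probability R R).
Implicit Types (B : set (R * R)) (D : set R).

(** Integrate the sections over [D] and over its complement separately: the complement is [P]-null,
    so nothing is asked of the sections there. [D] will be the half-line of nonnegative reals. *)
Lemma product_measure_le B D (c : R) :
  measurable B -> measurable D -> (0 <= c)%R -> P (~` D) = 0 ->
  (forall x, D x -> Q (xsection B x) <= c%:E) -> (P \x Q) B <= c%:E.
Proof.
move=> mB mD c0 PD0 Bc.
have mQ := measurable_fun_xsection Q mB.
rewrite /product_measure1 -(setvU D) ge0_integral_setU //=.
- rewrite null_set_integral //=; first last.
  + exact: measurable_funS mQ.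
  + exact: measurableC.
  rewrite add0e; apply: (@le_trans _ _ (\int[P]_(x in D) (cst c%:E) x)).
    apply: ge0_le_integral => //=; exact: measurable_funS mQ.
  rewrite integral_cst // -[leRHS]mule1; apply: lee_pmul => //.
  exact: probability_le1.
- exact: measurableC.
- exact: measurable_funS mQ.
- by apply/disj_setPS => x [].
Qed.

Lemma product_measure_ge B D (c : R) :
  measurable B -> measurable D -> (0 <= c)%R ->
  (forall x, D x -> c%:E <= Q (xsection B x)) -> c%:E * P D <= (P \x Q) B.
Proof.
move=> mB mD c0 Bc.
have mQ := measurable_fun_xsection Q mB.
rewrite -integral_cst // /product_measure1.
apply: (@le_trans _ _ (\int[P]_(x in D) (Q \o xsection B) x)).
  by apply: ge0_le_integral => //=; exact: measurable_funS mQ.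
exact: ge0_subset_integral.
Qed.

(** The product measure is determined by its values on rectangles, so integrating in the other order
    gives the same measure. *)
Lemma product_measure_swap B : measurable B ->
  (P \x Q) B = (Q \x P) [set z | B (z.2, z.1)].
Proof.
move=> mB; transitivity ((P \x^ Q) B).
  apply: product_measure_unique => // A1 A2 mA1 mA2.
  by rewrite /= product_measure2E.
apply: eq_integral => y _ /=; congr (P _).
Qed.
End product_probability.

(** The law being replaced is that of the first coordinate, hence Fubini is used in the order that
    integrates the y-sections against [Q]. *)
Lemma product_measure_le_compare {R : realType} (P P' Q : probability R R)
    (B : set (R * R)) (K : R) :
  (0 <= K)%R -> measurable B ->
  (forall y, P (ysection B y) <= K%:E * P' (ysection B y))%E ->
  ((P \x Q) B <= K%:E * (P' \x Q) B)%E.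
Proof.
move=> K0 mB BK.
have E (S : probability R R) : ((S \x Q) B = \int[Q]_y (S (ysection B y)))%E.
  transitivity (((S \x^ Q) B)%E) => //.
  by apply: product_measure_unique => // *; exact: product_measure2E.
have m (S : probability R R) := measurable_fun_ysection S mB.
rewrite !E -ge0_integralZl //; last exact: m.
apply: ge0_le_integral => //.
- exact: m.
- apply: measurable_funeM; exact: m.
Qed.

(** * Borel sets and distributions as MathComp-Analysis measures *)

Lemma borel_measurable (A : R -> Prop) : borel A -> measurable (A : set realR).
Proof.
elim=> [a b|B _ mB|B _ mB].
- rewrite (_ : (fun x => _) = (`]a, b]%classic : set realR)); first exact: measurable_itv.
  apply/seteqP; split=> x /=; rewrite in_itv /=.
    by move=> [/RltP -> /RleP ->].
  by move=> /andP[/RltP ? /RleP].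
- exact: measurableC.
- rewrite (_ : (fun x => _) = (\bigcup_n B n)%classic).
    exact: bigcupT_measurable.
  by apply/seteqP; split=> x [n]; exists n.
Qed.

Lemma borel_ext (A B : R -> Prop) : (forall x, A x <-> B x) -> borel A -> borel B.
Proof. by move=> AB bA; rewrite (_ : B = A) //; apply/seteqP; split=> x /AB. Qed.

Lemma borel_empty : borel (fun _ => False).
Proof. by apply: borel_ext (borel_Ioc R0 R0) => x; split=> // -[]; lra. Qed.

(** The measurable sets form the smallest sigma-algebra containing the half-open intervals, and
    [borel] is such a sigma-algebra. *)
Lemma measurable_borel (A : set realR) : measurable A -> borel A.
Proof.
apply: smallest_sub; last first.
  move=> _ [[a b] _ <-]; apply: borel_ext (borel_Ioc a b) => x /=.
  rewrite in_itv /=; split=> [[/RltP -> /RleP -> //]|/andP[/RltP ? /RleP ?] //].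
split.
- exact: borel_empty.
- by move=> B bB; rewrite setTD; apply: borel_compl.
- move=> B bB; apply: borel_ext (borel_union _ bB) => x; split=> -[n] //.
    by exists n.
  by move=> _; exists n.
Qed.

(** Apply sigma-additivity to a sequence of empty sets. If p is the mass of the empty set, the
    partial sums are multiples of p converging to p; two consecutive ones differ by p, yet both come
    within |p|/2 of the limit unless p = 0. *)
Lemma distribution_empty (F : (R -> Prop) -> R) :
  distribution_nonneg F -> F (fun _ => False) = 0%coqR.
Proof.
move=> [_ [_ [Fsum _]]].
have bF (n : nat) : borel ((fun _ _ => False) n) by exact: borel_empty.
have := Fsum (fun _ _ => False) bF (fun _ _ _ _ f _ => f).
rewrite (_ : (fun _ => exists _, False) = fun _ => False); last first.
  by apply/seteqP; split=> x // -[].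
set p := F _ => sp.
have [//|p0] := Req_dec p 0%coqR.
have /(sp _) [N HN] : (Rabs p / 2 > 0)%coqR by move: (Rabs_pos_lt _ p0); lra.
have := HN N (le_n N); have := HN N.+1 (le_S _ _ (le_n N)).
rewrite /Rdist /= => H1 H2; exfalso; move: H1 H2.
by rewrite /Rabs; do ?case: Rcase_abs => ? //; lra.
Qed.

Lemma sum_f_R0_big (f : nat -> R) n :
  sum_f_R0 f n = (\sum_(0 <= i < n.+1) f i)%R :> R.
Proof. by elim: n => [|n IH]; rewrite big_nat_recr //= -?IH // big_nil add0r. Qed.

Lemma cvg_sumEFin {K : realType} (f : nat -> K) (l : K) :
  (forall e, (0 < e)%R -> exists N, forall n, (N <= n)%N ->
     (`|\sum_(0 <= i < n) f i - l| < e)%R) ->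
  ((fun n => \sum_(0 <= i < n) (f i)%:E)%E @ \oo --> l%:E)%classic.
Proof.
move=> fl; under eq_fun do rewrite sumEFin.
apply: cvg_EFin; first by near=> n.
apply/cvgrPdist_lt => e /fl[N HN].
near=> n; rewrite /= distrC; apply: HN.
by near: n; exact: nbhs_infty_ge.
Unshelve. all: by end_near. Qed.

Section distribution_measure.
Local Open Scope classical_set_scope.
Local Open Scope ereal_scope.
Variables (F : (R -> Prop) -> R) (HF : distribution_nonneg F).

(* [F] is arbitrary, possibly negative, off the Borel sets. *)
Definition dist_mu (A : set realR) : \bar realR :=
  if `[< measurable A >] then (F A)%:E else 0.

Let dist_mu0 : dist_mu set0 = 0.
Proof. by rewrite /dist_mu asboolT // (distribution_empty _ HF). Qed.

Let dist_mu_ge0 A : 0 <= dist_mu A.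
Proof.
rewrite /dist_mu; case: asboolP => // /measurable_borel bA.
by rewrite lee_fin; apply/RleP; case: HF => + _; apply.
Qed.

Let dist_mu_sigma_additive : semi_sigma_additive dist_mu.
Proof.
move=> A mA tA mUA.
rewrite /dist_mu asboolT //.
have [_ [_ [Fsum _]]] := HF.
have dA m n x : m <> n -> A m x -> A n x -> False.
  by move=> mn Am An; apply/mn/(tA m n) => //; exists x.
have {}Fsum := Fsum A (fun n => measurable_borel _ (mA n)) dA.
rewrite (_ : (fun n => _) =
    (fun n => \sum_(0 <= i < n) (F (A i) : realR)%:E)); last first.
  by apply/funext => n; apply: eq_bigr => i _; rewrite asboolT.
(* [sum_f_R0] up to n has n+1 terms, the big sum below n has n, so the threshold moves by one. *)
apply: cvg_sumEFin => e /RltP /Fsum[N HN]; exists N.+1 => -[//|n] /ssrnat.leP /le_S_n /HN.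
rewrite sum_f_R0_big /Rdist RabsE => /RltP.
rewrite (_ : (fun x => exists n, A n x) = \bigcup_n A n) //.
by apply/seteqP; split=> x [k]; exists k.
Qed.

HB.instance Definition _ := isMeasure.Build _ _ _ dist_mu
  dist_mu0 dist_mu_ge0 dist_mu_sigma_additive.

Let dist_mu_setT : dist_mu setT = 1.
Proof. by rewrite /dist_mu asboolT //; case: HF => _ [-> _]. Qed.

HB.instance Definition _ :=
  Measure_isProbability.Build _ _ _ dist_mu dist_mu_setT.

Lemma distribution_probability :
  exists P : probability realR realR, forall A, borel A -> P A = (F A)%:E.
Proof.
exists dist_mu => A bA; rewrite /= /dist_mu asboolT //.
exact: borel_measurable.
Qed.

End distribution_measure.

(** * The integral and the convolution of Defs *)

(** Agreement is asked on Borel sets only, because [F] may take any value elsewhere. *)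
Definition has_law (P : probability realR realR) (F : (R -> Prop) -> R) :=
  forall A, borel A -> P A = (F A)%:E.

Lemma Rsup_eq (E : R -> Prop) l : is_lub E l -> Rsup E = l.
Proof.
rewrite /Rsup => El; case: excluded_middle_informative => [H|[]]; last by exists l.
case: (ClassicalEpsilon.constructive_indefinite_description _ H) => m /= Em.
by apply: Rle_antisym; [apply: Em.2; exact: El.1|apply: El.2; exact: Em.1].
Qed.

(* Evaluates to d * floor (f / d), capped at m * d. *)
Fixpoint staircase (f : R -> R) (d : R) (m : nat) : list (R * (R -> Prop)) :=
  match m with
  | O => nil
  | S k => cons (d, fun x => INR (S k) * d <= f x) (staircase f d k)
  end.

Lemma staircaseP f d m x : 0 < d -> 0 <= f x ->
  simple_eval (staircase f d m) x <= f x /\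
  (INR m * d <= simple_eval (staircase f d m) x \/
   f x < simple_eval (staircase f d m) x + d).
Proof.
move=> d0 f0.
(* The additional bound by m d makes the induction work: once f x reaches (m+1) d, adding one more
   step d keeps the staircase below f x. *)
suff: simple_eval (staircase f d m) x <= INR m * d /\
  simple_eval (staircase f d m) x <= f x /\
  (INR m * d <= simple_eval (staircase f d m) x \/
   f x < simple_eval (staircase f d m) x + d) by tauto.
elim: m => [|m [IH1 [IH2 IH3]]].
  by rewrite /simple_eval /INR /=; lra.
have -> : simple_eval (staircase f d m.+1) x =
  d * indic (fun x => INR m.+1 * d <= f x) x + simple_eval (staircase f d m) x.
  by [].
by rewrite /indic S_INR; case: excluded_middle_informative => /=; lra.
Qed.

Section integral_law.
Local Open Scope classical_set_scope.
Variables (P : probability realR realR) (F : (R -> Prop) -> R).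
Hypothesis PF : has_law P F.

Let simple (s : list (R * (R -> Prop))) :=
  Forall (fun p => 0 <= fst p /\ borel (snd p)) s.

Lemma indicE_realR (A : set realR) x : indic A x = (\1_A x : realR)%R.
Proof.
rewrite /indic indicE; case: excluded_middle_informative => Ax.
  by rewrite mem_set.
by rewrite memNset.
Qed.

Lemma simple_eval_ge0 s x : simple s -> 0 <= simple_eval s x.
Proof.
elim=> [|p {}s [p0 _] _ IH] /=; first exact: Rle_refl.
apply: Rplus_le_le_0_compat => //; apply: Rmult_le_pos => //.
by rewrite /indic; case: excluded_middle_informative => _; lra.
Qed.

Lemma measurable_simple_eval s : simple s ->
  measurable_fun setT (simple_eval s : realR -> realR).
Proof.
elim=> [|p {}s [p0 bp] _ IH] /=; first exact: measurable_cst.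
rewrite [X in measurable_fun _ X](_ : _ =
    ((fun x => p.1 * (\1_(p.2) x : realR)) \+ simple_eval s)%R).
  apply: measurable_funD => //; apply: measurable_funM => //.
  by apply: measurable_indic; exact: borel_measurable.
by apply/funext => x /=; rewrite indicE_realR.
Qed.

Lemma integral_simple_eval s : simple s ->
  (\int[P]_x (simple_eval s x : realR)%:E = (simple_int F s)%:E)%E.
Proof.
elim=> [|p {}s [p0 bp] ss IH] /=; first exact: integral0.
have mp := borel_measurable _ bp.
under eq_integral => x _ do rewrite indicE_realR.
rewrite -[in RHS]/(simple_int F s) -/(simple_eval s).
under eq_integral => x _ do rewrite EFinD EFinM -/(simple_eval s x).
rewrite ge0_integralD //=.
- rewrite IH ge0_integralZl //=.
  + by rewrite integral_indic // setIT RplusE RmultE EFinD EFinM -(PF _ bp).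
  + exact/measurable_EFinP/measurable_indic.
  + by rewrite lee_fin; apply/RleP.
- by move=> x _; rewrite -EFinM lee_fin mulr_ge0 //; apply/RleP.
- apply/measurable_EFinP/measurable_funM => //; exact: measurable_indic.
- by move=> x _; rewrite lee_fin; apply/RleP/simple_eval_ge0.
- apply/measurable_EFinP; exact: measurable_simple_eval.
Qed.

Lemma simple_staircase (f : realR -> realR) d m :
  measurable_fun setT f -> 0 < d -> simple (staircase f d m).
Proof.
move=> mf d0; elim: m => [|m IH]; first exact: Forall_nil.
apply: Forall_cons => //; split; first exact: Rlt_le.
apply: measurable_borel.
rewrite (_ : (fun x => _) = setT `&` f @^-1` `[(INR m.+1 * d : realR), +oo[).
  by apply: mf => //; exact: measurable_itv.
by rewrite setTI; apply/seteqP; split=> x /=; rewrite in_itv /= andbT => /RleP.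
Qed.

(** Monotonicity bounds every simple function below f. Conversely a staircase of step d stays within
    d of f, so the total mass 1 makes its integral fall short by at most d. *)
Lemma integral_has_law (f : realR -> realR) :
  measurable_fun setT f -> (forall x, 0 <= f x <= 1) ->
  (\int[P]_x (f x)%:E = (integral F f)%:E)%E.
Proof.
move=> mf f01.
have mEf : measurable_fun setT (EFin \o f) by exact/measurable_EFinP.
have f0 x : (0 <= (f x)%:E)%E by rewrite lee_fin; apply/RleP; case: (f01 x).
have If1 : (\int[P]_x (f x)%:E <= 1)%E.
  rewrite -(probability_setT P) -[leRHS]mul1e -integral_cst //.
  apply: ge0_le_integral => //= x _.
  by rewrite lee_fin; apply/RleP; case: (f01 x).
have If0 : (0 <= \int[P]_x (f x)%:E)%E by exact: integral_ge0.
have Ifin : (\int[P]_x (f x)%:E)%E \is a fin_num.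
  by rewrite ge0_fin_numE // (le_lt_trans If1) // ltry.
rewrite -[LHS]fineK //; congr EFin; apply/esym/Rsup_eq; split.
- move=> _ [s [ss [sf ->]]]; apply/RleP; rewrite -lee_fin fineK //.
  rewrite -integral_simple_eval //; apply: ge0_le_integral => //=.
  + by move=> x _; rewrite lee_fin; apply/RleP/simple_eval_ge0.
  + apply/measurable_EFinP; exact: measurable_simple_eval.
  + by move=> x _; rewrite lee_fin; apply/RleP.
- move=> b ub; apply: le_epsilon => d d0.
  (* With N d >= 1 >= f the cap of the staircase does no harm. *)
  have [N Nd] : exists N, 1 <= INR N * d.
    have [N HN] := INR_unbounded (/ d); exists N.
    by rewrite -(Rinv_l d); [apply: Rmult_le_compat_r|]; lra.
  have ss := simple_staircase f d N mf d0.
  have sP x := staircaseP f d N x d0 (proj1 (f01 x)).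
  have {}ub := ub _ (ex_intro _ _ (conj ss (conj (fun x => proj1 (sP x)) erefl))).
  apply: (Rle_trans _ (simple_int F (staircase f d N) + d)); last lra.
  have ms := measurable_simple_eval _ ss.
  apply/RleP; rewrite -lee_fin fineK // RplusE EFinD -integral_simple_eval //.
  rewrite -[(d%:E)%E]mule1 -(probability_setT P) -integral_cst // -ge0_integralD //.
  + apply: ge0_le_integral => //=.
    * by apply: emeasurable_funD => //; apply/measurable_EFinP.
    * move=> x _; rewrite -EFinD lee_fin; apply/RleP; rewrite -RplusE.
      by have [_ []] := sP x; have := f01 x; lra.
  + by move=> x _; rewrite lee_fin; apply/RleP; exact: simple_eval_ge0.
  + exact/measurable_EFinP.
  + by move=> x _; rewrite lee_fin; apply/RleP/Rlt_le.
Qed.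
End integral_law.

(** The order [z.2 + z.1] matches [A (z + y)] in [conv], where y is the coordinate integrated
    against the first law. *)
Definition sum_event (A : R -> Prop) : set (realR * realR) :=
  fun z => A (z.2 + z.1).

Lemma measurable_sum_event A : borel A -> measurable (sum_event A).
Proof.
move=> /borel_measurable mA.
have mS : measurable_fun setT (fun z : realR * realR => z.2 + z.1)%R.
  exact: measurable_funD.
by have := mS measurableT _ mA; rewrite setTI.
Qed.

Lemma xsection_sum_event A (y : realR) :
  xsection (sum_event A) y = (fun z => A (z + y)).
Proof. by apply/seteqP; split=> x; rewrite /xsection /= inE. Qed.

Section convolution_law.
Variables (P Q : probability realR realR) (F G : (R -> Prop) -> R).
Hypotheses (PF : has_law P F) (QG : has_law Q G).

Lemma conv_product A : borel A -> (P \x Q)%E (sum_event A) = (conv F G A)%:E.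
Proof.
move=> bA; have mB := measurable_sum_event _ bA.
have mX (y : realR) : measurable (xsection (sum_event A) y).
  exact: measurable_xsection.
have GE (y : realR) : Q (xsection (sum_event A) y) = (G (fun z => A (z + y)))%:E.
  rewrite xsection_sum_event; apply: QG; rewrite -(xsection_sum_event A y).
  exact: (measurable_borel _ (mX y)).
rewrite -(integral_has_law _ _ PF).
- by apply: eq_integral => y _; rewrite /= GE.
- apply/measurable_EFinP.
  have := measurable_fun_xsection Q mB.
  by rewrite (_ : _ \o _ = EFin \o (fun y => G (fun z => A (z + y)))) //; apply/funext.
- move=> y; have G1 : (Q (xsection (sum_event A) y) <= 1)%E.
    exact: (probability_le1 Q (mX y)).
  have G0 : (0 <= Q (xsection (sum_event A) y))%E by [].
  rewrite GE lee_fin in G0; rewrite GE lee_fin in G1.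
  by move/RleP: G0 => G0; move/RleP: G1 => G1; split; [exact G0|exact G1].
Qed.

(** The witness is the image of the product measure under addition. *)
Lemma conv_has_law : exists PQ, has_law PQ (conv F G).
Proof.
have mS : measurable_fun setT (fun z : realR * realR => z.2 + z.1)%R.
  exact: measurable_funD.
pose S : {mfun (realR * realR)%type >-> realR} :=
  HB.pack (fun z : realR * realR => z.2 + z.1)%R (isMeasurableFun.Build _ _ _ _ _ mS).
by exists (distribution (P \x Q)%E S) => A bA; rewrite -conv_product // /=.
Qed.

End convolution_law.

Lemma dirac0_has_law : exists P, has_law P dirac0.
Proof.
by exists (dirac (0%R : realR)) => A bA; rewrite /dirac0 indicE_realR /= /dirac.
Qed.

(** * Elementary Borel sets, tightness and basic properties of laws *)

Lemma borel_inter (A B : R -> Prop) : borel A -> borel B -> borel (fun x => A x /\ B x).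
Proof.
move=> /borel_measurable mA /borel_measurable mB.
exact: (measurable_borel _ (measurableI _ _ mA mB)).
Qed.

Lemma borel_true : borel (fun _ => True).
Proof. by apply: borel_ext (borel_compl _ borel_empty) => x; tauto. Qed.

Lemma borel_le a : borel (fun x => x <= a).
Proof.
apply: borel_ext (measurable_borel _ (measurable_itv `]-oo, (a : realR)]%R)) => x /=.
by rewrite in_itv /=; split=> /RleP.
Qed.

Lemma borel_gt a : borel (fun x => a < x).
Proof. by apply: borel_ext (borel_compl _ (borel_le a)) => x; lra. Qed.

Lemma borel_ge a : borel (fun x => a <= x).
Proof.
apply: borel_ext (measurable_borel _ (measurable_itv `[(a : realR), +oo[%R)) => x /=.
by rewrite in_itv /= andbT; split=> /RleP.
Qed.

Lemma borel_lt a : borel (fun x => x < a).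
Proof. by apply: borel_ext (borel_compl _ (borel_ge a)) => x; lra. Qed.

Lemma borel_ival x T : borel (ival x T).
Proof. by case: T => [t|]; [exact: borel_Ioc|exact: borel_gt]. Qed.

Section tightness.
Local Open Scope classical_set_scope.
Local Open Scope ring_scope.

(** Continuity from below along the half-lines ending at n, whose union is the whole line. *)
Lemma probability_tight {K : realType} (P : probability K K) (e : K) :
  (0 < e)%R -> exists n : nat, ((1 - e)%:E < P `]-oo, n%:R]%classic)%E.
Proof.
move=> e0.
have : (P \o (fun n : nat => `]-oo, (n%:R : K)]%classic) @ \oo -->
    P (\bigcup_n `]-oo, (n%:R : K)]))%classic.
  apply: nondecreasing_cvg_mu => //; first exact: bigcupT_measurable.
  move=> m n mn; apply/subsetPset => x /=; rewrite !in_itv /= => /le_trans; apply.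
  by rewrite ler_nat.
rewrite (_ : (\bigcup_n `]-oo, (n%:R : K)] = setT)%classic); last first.
  apply/seteqP; split=> // x _; exists (Num.truncn `|x|).+1 => //=.
  by rewrite in_itv /= (le_trans (ler_norm x)) // ltW // truncnS_gt.
rewrite probability_setT => /fine_cvgP[fP /cvgrPdist_lt/(_ e e0) H].
near \oo => n; exists n.
have Pn : P `]-oo, n%:R]%classic \is a fin_num by near: n.
rewrite -(fineK Pn) lte_fin ltrBlDr -ltrBlDl.
apply: le_lt_trans (ler_norm _) _; by near: n.
Unshelve. all: by end_near. Qed.

End tightness.

Section law.
Variables (P : probability realR realR) (F : (R -> Prop) -> R).
Hypothesis PF : has_law P F.

Lemma law_ge0 A : borel A -> 0 <= F A.
Proof.
move=> bA; have : (0 <= P A)%E by [].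
by rewrite (PF _ bA) lee_fin => /RleP.
Qed.

Lemma law_le1 A : borel A -> F A <= 1.
Proof.
move=> bA; have : (P A <= 1)%E.
  exact: (probability_le1 P (borel_measurable _ bA)).
by rewrite (PF _ bA) lee_fin => /RleP.
Qed.

Lemma law_mono A B : borel A -> borel B -> (forall x, A x -> B x) -> F A <= F B.
Proof.
move=> bA bB AB; have : (P A <= P B)%E.
  by apply: le_measure; rewrite ?inE //; exact: borel_measurable.
by rewrite (PF _ bA) (PF _ bB) lee_fin => /RleP.
Qed.

Lemma law_eq A B : (forall x, A x <-> B x) -> F A = F B.
Proof. by move=> AB; congr F; apply/seteqP; split=> x /AB. Qed.

Lemma law_true : F (fun _ => True) = 1.
Proof.
have := probability_setT P; have := PF _ borel_true.
by rewrite /setT => -> [].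
Qed.

Lemma law_split A B : borel A -> borel B ->
  F A = F (fun x => A x /\ B x) + F (fun x => A x /\ ~ B x).
Proof.
move=> bA bB; have b1 := borel_inter _ _ bA bB.
have b2 := borel_inter _ _ bA (borel_compl _ bB).
have : P (fun x => (A x /\ B x) \/ (A x /\ ~ B x)) =
  (P (fun x => A x /\ B x) + P (fun x => A x /\ ~ B x))%E.
  apply: measureU; try exact: borel_measurable.
  by apply/seteqP; split=> x //= [[_ Bx] [_ nBx]].
rewrite (PF _ b1) (PF _ b2) (_ : (fun x => _ \/ _) = A).
  by rewrite (PF _ bA) -EFinD => -[->].
by apply/seteqP; split=> x; have [?|?] := pselect (B x); tauto.
Qed.

Lemma law_empty : F (fun _ => False) = 0.
Proof.
have := law_split _ _ borel_empty borel_true.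
rewrite (law_eq (fun x => False /\ True) (fun _ => False)); last by tauto.
by rewrite (law_eq (fun x => False /\ ~ True) (fun _ => False)); [lra|tauto].
Qed.

Lemma law_compl A : borel A -> F (fun x => ~ A x) = 1 - F A.
Proof.
move=> bA; have := law_split _ _ borel_true bA; rewrite law_true.
rewrite (law_eq (fun x => True /\ A x) A); last by tauto.
by rewrite (law_eq (fun x => True /\ ~ A x) (fun x => ~ A x)); [lra|tauto].
Qed.

Lemma law_tight eps : 0 < eps -> exists a, 0 <= a /\ 1 - eps < F (fun x => x <= a).
Proof.
move/RltP => /(probability_tight P) [n].
rewrite (_ : `]-oo, n%:R%R]%classic = (fun x => x <= INR n)).
  rewrite (PF _ (borel_le _)) lte_fin => /RltP ?.
  by exists (INR n); split; first exact: pos_INR.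
by apply/seteqP; split=> x /=; rewrite in_itv /= -INRE => /RleP.
Qed.
End law.

(** * Joint laws of two independent summands *)

Definition sum_event_on (A B1 B2 : R -> Prop) : set (realR * realR) :=
  fun z => A (z.2 + z.1) /\ B1 z.1 /\ B2 z.2.

(** Probability that independent summands lie in [B1] and [B2] and their sum in [A]; [fine] loses
    nothing on measurable events, where the mass is finite. *)
Definition joint (P Q : probability realR realR) (A B1 B2 : R -> Prop) : R :=
  fine ((P \x Q)%E (sum_event_on A B1 B2)).

Lemma measurable_sum_event_on A B1 B2 : borel A -> borel B1 -> borel B2 ->
  measurable (sum_event_on A B1 B2).
Proof.
move=> bA b1 b2.
have m1 : measurable (fun z : realR * realR => B1 z.1).
  have m : measurable_fun setT (fun z : realR * realR => z.1).
    exact: measurable_fst.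
  by have := m measurableT _ (borel_measurable _ b1); rewrite setTI.
have m2 : measurable (fun z : realR * realR => B2 z.2).
  have m : measurable_fun setT (fun z : realR * realR => z.2).
    exact: measurable_snd.
  by have := m measurableT _ (borel_measurable _ b2); rewrite setTI.
exact: measurableI (measurable_sum_event _ bA) (measurableI _ _ m1 m2).
Qed.

Lemma xsection_sum_event_on A (B1 B2 : R -> Prop) (x : realR) : B1 x ->
  xsection (sum_event_on A B1 B2) x = (fun y => A (y + x) /\ B2 y).
Proof.
by move=> Bx; apply/seteqP; split=> y; rewrite /xsection /= inE /sum_event_on /=; tauto.
Qed.

Lemma ysection_sum_event_on A (B1 B2 : R -> Prop) (y : realR) : B2 y ->
  ysection (sum_event_on A B1 B2) y = (fun x => A (y + x) /\ B1 x).
Proof.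
by move=> Bx; apply/seteqP; split=> x; rewrite /ysection /= inE /sum_event_on /=; tauto.
Qed.

Lemma borel_shift A x : borel A -> borel (fun y => A (y + x)).
Proof.
move=> bA; have := measurable_xsection (x : realR) (measurable_sum_event _ bA).
by rewrite xsection_sum_event => /measurable_borel.
Qed.

Lemma fin_num_product {K : realType} (P Q : probability K K) (B : set (K * K)) :
  measurable B -> ((P \x Q) B \is a fin_num)%E.
Proof. exact: (fin_num_measure ((P \x Q)%E : probability (K * K)%type K) B). Qed.

Section joint.
Variables (P Q : probability realR realR) (F G : (R -> Prop) -> R).
Hypotheses (PF : has_law P F) (QG : has_law Q G).
Variables (A B1 B2 : R -> Prop).
Hypotheses (bA : borel A) (b1 : borel B1) (b2 : borel B2).

Lemma jointE (B1' B2' : R -> Prop) : borel B1' -> borel B2' ->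
  ((joint P Q A B1' B2')%:E = (P \x Q) (sum_event_on A B1' B2'))%E.
Proof.
move=> b1' b2'; rewrite /joint fineK //.
by apply: fin_num_product; exact: measurable_sum_event_on.
Qed.

Lemma conv_joint : conv F G A = joint P Q A (fun _ => True) (fun _ => True).
Proof.
apply: EFin_inj; rewrite jointE; try exact: borel_true.
rewrite -(conv_product _ _ _ _ PF QG) //; congr ((_ \x _)%E _).
by apply/seteqP; split=> z; rewrite /sum_event_on; tauto.
Qed.

Lemma joint_splitr C : borel C ->
  joint P Q A B1 B2 = joint P Q A B1 (fun y => B2 y /\ C y) +
                      joint P Q A B1 (fun y => B2 y /\ ~ C y).
Proof.
move=> bC; have b3 := borel_inter _ _ b2 bC.
have b4 := borel_inter _ _ b2 (borel_compl _ bC).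
apply: EFin_inj; rewrite RplusE EFinD !jointE // -measureU //.
- congr ((_ \x _)%E _); apply/seteqP; split=> z; rewrite /sum_event_on /=.
    by have [?|?] := pselect (C z.2); tauto.
  by rewrite /setU /=; tauto.
- exact: measurable_sum_event_on.
- exact: measurable_sum_event_on.
- by apply/seteqP; split=> z //=; rewrite /sum_event_on /setI /=; tauto.
Qed.

Lemma joint_swap : joint P Q A B1 B2 = joint Q P A B2 B1.
Proof.
rewrite /joint product_measure_swap; last exact: measurable_sum_event_on.
congr (fine ((_ \x _)%E _)); apply/seteqP.
by split=> z; rewrite /sum_event_on /= Rplus_comm; tauto.
Qed.

Lemma joint_le c : F (fun x => x < 0) = 0 -> 0 <= c ->
  (forall x, 0 <= x -> B1 x -> G (fun y => A (y + x) /\ B2 y) <= c) ->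
  joint P Q A B1 B2 <= c.
Proof.
move=> F0 c0 Gc; apply/RleP; rewrite -lee_fin jointE //.
apply: (product_measure_le _ _ _ (fun x => 0 <= x)).
- exact: measurable_sum_event_on.
- exact: (borel_measurable _ (borel_ge 0)).
- exact/RleP.
- transitivity (P (fun x => x < 0)); last by rewrite (PF _ (borel_lt 0)) F0.
  by congr (P _); apply/seteqP; split=> x /=; rewrite /setC /=; lra.
- move=> x x0; have [Bx|nBx] := pselect (B1 x).
    rewrite xsection_sum_event_on // (QG _ _) ?lee_fin; first exact/RleP/Gc.
    by apply: borel_inter => //; exact: borel_shift.
  rewrite (_ : xsection _ _ = set0) ?measure0 ?lee_fin; first exact/RleP.
  by apply/seteqP; split=> y //; rewrite /xsection /= inE /sum_event_on /=; tauto.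
Qed.

Lemma joint_ge c D : 0 <= c -> borel D -> (forall x, D x -> B1 x) ->
  (forall x, D x -> c <= G (fun y => A (y + x) /\ B2 y)) ->
  c * F D <= joint P Q A B1 B2.
Proof.
move=> c0 bD DB Gc; apply/RleP; rewrite -lee_fin jointE // RmultE EFinM -(PF _ bD).
apply: product_measure_ge.
- exact: measurable_sum_event_on.
- exact: borel_measurable.
- exact/RleP.
- move=> x Dx; rewrite xsection_sum_event_on; last exact: DB.
  rewrite (QG _ _) ?lee_fin; first exact/RleP/Gc.
  by apply: borel_inter => //; exact: borel_shift.
Qed.

Lemma joint_le_compare (P' : probability realR realR) F' K :
  has_law P' F' -> 0 <= K ->
  (forall y, B2 y -> F (fun x => A (y + x) /\ B1 x) <=
                     K * F' (fun x => A (y + x) /\ B1 x)) ->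
  joint P Q A B1 B2 <= K * joint P' Q A B1 B2.
Proof.
move=> PF' K0 FK.
have : ((P \x Q) (sum_event_on A B1 B2) <=
    (K : realR)%:E * (P' \x Q) (sum_event_on A B1 B2))%E.
  apply: product_measure_le_compare.
  - exact/RleP.
  - exact: measurable_sum_event_on.
  - move=> y; have [By|nBy] := pselect (B2 y).
      rewrite ysection_sum_event_on //.
      have bS : borel (fun x => A (y + x) /\ B1 x).
        apply: borel_inter => //; apply: borel_ext (borel_shift _ y bA) => x.
        by rewrite Rplus_comm.
      by rewrite (PF _ bS) (PF' _ bS) -EFinM lee_fin; exact/RleP/FK.
    rewrite (_ : ysection _ _ = set0) ?measure0 ?mule0 //.
    by apply/seteqP; split=> x //; rewrite /ysection /= inE /sum_event_on /=; tauto.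
have := measurable_sum_event_on _ _ _ bA b1 b2.
move=> /(fin_num_product P' Q) /fineK {1}<-.
by rewrite -jointE // -EFinM lee_fin => /RleP.
Qed.
End joint.

(** * Bounds for the convolution of local masses *)

Definition nonneg_law (P : probability realR realR) (F : (R -> Prop) -> R) :=
  has_law P F /\ F (fun x => x < 0) = 0.

Lemma nonneg_law_dirac0 : exists P, nonneg_law P dirac0.
Proof.
have [P DP] := dirac0_has_law; exists P; split=> //.
by rewrite /dirac0 /indic; case: excluded_middle_informative => //; lra.
Qed.

(** When the first summand is nonnegative, a negative sum forces a negative second summand, which is
    a null event. *)
Lemma nonneg_law_conv P Q F G : nonneg_law P F -> nonneg_law Q G ->
  exists PQ, nonneg_law PQ (conv F G).
Proof.
move=> [PF F0] [QG G0]; have [PQ PQE] := conv_has_law _ _ _ _ PF QG.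
exists PQ; split=> //; have bT := borel_true; have b0 := borel_lt 0.
apply: Rle_antisym; last exact: (law_ge0 _ _ PQE).
rewrite (conv_joint _ _ _ _ PF QG) //.
apply: (joint_le _ _ _ _ PF QG) => //; first exact: Rle_refl.
move=> x x0 _; apply: Rle_trans (Req_le _ _ G0); apply: (law_mono _ _ QG) => //.
  by apply: borel_inter => //; exact: (borel_shift _ x b0).
by move=> y; lra.
Qed.

(** The event that the first summand is 0 gives one inequality for every Borel set. Applied to the
    complement it gives the other, both total masses being 1. *)
Lemma conv_dirac0 P F A : has_law P F -> borel A -> conv dirac0 F A = F A.
Proof.
move=> PF bA; have [D DE] := dirac0_has_law.
have [DP DPE] := conv_has_law _ _ _ _ DE PF.
have le B : borel B -> F B <= conv dirac0 F B.
  move=> bB; rewrite (conv_joint _ _ _ _ DE PF) //.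
  have b0 : borel (fun x => x = 0).
    by apply: borel_ext (borel_inter _ _ (borel_le 0) (borel_ge 0)) => x; lra.
  have -> : F B = F B * dirac0 (fun x => x = 0).
    by rewrite /dirac0 /indic; case: excluded_middle_informative => //; lra.
  apply: (joint_ge _ _ _ _ DE PF) => //; try exact: borel_true.
    exact: (law_ge0 _ _ PF).
  move=> x ->; apply: Req_le; apply: law_eq => y.
  by rewrite Rplus_0_r; tauto.
have := le _ (borel_compl _ bA); rewrite (law_compl _ _ PF) // (law_compl _ _ DPE) //.
by have := le _ bA; lra.
Qed.

Lemma nonneg_law_le P F a : nonneg_law P F ->
  F (fun y => y <= a) = F (fun y => 0 <= y <= a).
Proof.
move=> [PF F0]; rewrite (law_split _ _ PF _ _ (borel_le a) (borel_ge 0)).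
have b : borel (fun y => y <= a /\ ~ 0 <= y).
  exact: borel_inter (borel_le a) (borel_compl _ (borel_ge 0)).
have -> : F (fun y => y <= a /\ ~ 0 <= y) = 0.
  apply: Rle_antisym; last exact: (law_ge0 _ _ PF).
  apply: Rle_trans (Req_le _ _ F0); apply: (law_mono _ _ PF) => //.
    exact: borel_lt.
  by move=> y; lra.
by rewrite Rplus_0_r; apply: law_eq => y; lra.
Qed.

Section convolution_bounds.
Variables (P Q : probability realR realR) (F G : (R -> Prop) -> R).
Hypotheses (PF : nonneg_law P F) (QG : nonneg_law Q G).
Variable T : option R.

Let bT := borel_true.

(** Split at x - a the last summand y, of law [F]. The part y > x - a has mass at most C. If y <= x
    - a, the first summand lies in an interval starting at x - y >= a, where G is at most K F. This
    leaves K times the mass of two [F]-summands with the second at most x - a; the complementary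
    mass, at least L F[0,a], is subtracted from [conv F F]. *)
Lemma conv_upper a x K C L : 0 <= K -> 0 <= C -> 0 <= L ->
  (forall z, a <= z -> G (ival z T) <= K * F (ival z T)) ->
  (forall z, 0 <= z -> F (fun y => ival (x - z) T y /\ x - a < y) <= C) ->
  (forall y, 0 <= y <= a -> L <= F (ival (x - y) T)) ->
  conv G F (ival x T) <=
    K * (conv F F (ival x T) - L * F (fun y => y <= a)) + C.
Proof.
move=> K0 C0 L0 GK FC FL; have [PF' F0] := PF; have [QG' G0] := QG.
have bI := borel_ival x T; have ba := borel_le (x - a).
have bTa := borel_inter _ _ bT ba.
have bTa' := borel_inter _ _ bT (borel_compl _ ba).
rewrite (conv_joint _ _ _ _ QG' PF') // (conv_joint _ _ _ _ PF' PF') //.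
rewrite !(joint_splitr _ _ _ _ _ bI bT bT _ ba).
have shift y z : ival x T (y + z) <-> ival (x - z) T y.
  by case: T => [t|] /=; lra.
have H1 : joint Q P (ival x T) (fun _ => True) (fun y => True /\ y <= x - a) <=
    K * joint P P (ival x T) (fun _ => True) (fun y => True /\ y <= x - a).
  apply: (joint_le_compare _ _ _ QG' _ _ _ bI bT bTa _ F) => // y [_ ya].
  have E H : H (fun z => ival x T (y + z) /\ True) = H (ival (x - y) T) :> R.
    by apply: law_eq => z; rewrite Rplus_comm shift; tauto.
  by rewrite !E; apply: GK; lra.
have H2 : joint Q P (ival x T) (fun _ => True) (fun y => True /\ ~ y <= x - a) <= C.
  apply: (joint_le _ _ _ _ QG' PF') => // z z0 _.
  apply: Rle_trans (FC z z0); apply: Req_le; apply: law_eq => y.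
  by rewrite shift; split=> -[? ?]; split=> //; lra.
have H3 : L * F (fun y => 0 <= y <= a) <=
    joint P P (ival x T) (fun _ => True) (fun y => True /\ ~ y <= x - a).
  apply: (joint_ge _ _ _ _ PF' PF') => //.
    exact: borel_inter (borel_ge 0) (borel_le a).
  move=> z za; apply: Rle_trans (FL z za) _; apply: Req_le; apply: law_eq => y.
  by rewrite shift; case: T => [t|] /=; lra.
have := Rmult_le_compat_l K _ _ K0 H3; rewrite -(nonneg_law_le _ _ _ PF); lra.
Qed.

(** The two terms come from disjoint events: a first summand at most a pushes the second above x - a
    >= a. *)
Lemma conv_lower a x L1 L2 : 2 * a <= x -> 0 <= L1 -> 0 <= L2 ->
  (forall y, 0 <= y <= a -> L1 <= G (ival (x - y) T)) ->
  (forall y, 0 <= y <= a -> L2 <= F (ival (x - y) T)) ->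
  L1 * F (fun y => y <= a) + L2 * G (fun y => y <= a) <= conv G F (ival x T).
Proof.
move=> ax L10 L20 GL FL; have [PF' F0] := PF; have [QG' G0] := QG.
have bI := borel_ival x T; have ba := borel_le a.
have b0a := borel_inter _ _ (borel_ge 0) (borel_le a).
have bTa := borel_inter _ _ bT ba.
have bTa' := borel_inter _ _ bT (borel_compl _ ba).
have shift y z : ival x T (y + z) <-> ival (x - z) T y.
  by case: T => [t|] /=; lra.
rewrite (conv_joint _ _ _ _ QG' PF') // (joint_splitr _ _ _ _ _ bI bT bT _ ba).
rewrite (nonneg_law_le _ _ _ PF) (nonneg_law_le _ _ _ QG); apply: Rplus_le_compat.
  rewrite joint_swap //; apply: (joint_ge _ _ _ _ PF' QG') => //.
    by move=> y; lra.
  move=> y ya; apply: Rle_trans (GL y ya) _; apply: Req_le; apply: law_eq => z.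
  by rewrite shift; tauto.
apply: (joint_ge _ _ _ _ QG' PF') => //.
move=> z za; apply: Rle_trans (FL z za) _; apply: Req_le; apply: law_eq => y.
by rewrite shift; case: T => [t|] /=; lra.
Qed.
End convolution_bounds.

(** Split by the second summand y. If y > x, any nonnegative first summand will do; if y is in
    [0,t], a first summand above x suffices; if y is in (t,x], one above x - t suffices. *)
Lemma conv_tail_lower P F t x : nonneg_law P F -> 0 <= t <= x ->
  let f z := F (ival z None) in
  f x + f x * F (fun y => y <= t) + f (x - t) * (1 - F (fun y => y <= t) - f x)
    <= conv F F (ival x None).
Proof.
move=> PF tx f; have [PF' F0] := PF; have bT := borel_true.
have bI := borel_ival x None; have bx := borel_le x; have bt := borel_le t.
have f0 z : 0 <= f z by apply: (law_ge0 _ _ PF'); exact: borel_gt.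
have b0t := borel_inter _ _ (borel_ge 0) (borel_le t).
have btx := borel_Ioc t x.
have b1 := borel_inter _ _ bT bx; have b1' := borel_inter _ _ bT (borel_compl _ bx).
have b2 := borel_inter _ _ b1 bt; have b2' := borel_inter _ _ b1 (borel_compl _ bt).
rewrite (conv_joint _ _ _ _ PF' PF') // (joint_splitr _ _ _ _ _ bI bT bT _ bx).
rewrite (joint_splitr _ _ _ _ _ bI bT b1 _ bt).
have bS y : borel (fun z => ival x None (z + y) /\ True).
  by apply: borel_inter => //; exact: (borel_shift _ y bI).
have H1 : f x * F (fun y => 0 <= y <= t) <=
    joint P P (ival x None) (fun _ => True) (fun y => (True /\ y <= x) /\ y <= t).
  rewrite joint_swap //; apply: (joint_ge _ _ _ _ PF' PF') => //.
    by move=> y; lra.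
  by move=> y y0; apply: (law_mono _ _ PF') => // z /=; lra.
have H2 : f (x - t) * F (fun y => t < y <= x) <=
    joint P P (ival x None) (fun _ => True) (fun y => (True /\ y <= x) /\ ~ y <= t).
  rewrite joint_swap //; apply: (joint_ge _ _ _ _ PF' PF') => //.
    by move=> y; lra.
  move=> y y0; apply: (law_mono _ _ PF') => //; first exact: borel_gt.
  by move=> z /=; lra.
have H3 : f x * F (fun y => 0 <= y) <=
    joint P P (ival x None) (fun _ => True) (fun y => True /\ ~ y <= x).
  apply: (joint_ge _ _ _ _ PF' PF') => //; first exact: borel_ge.
  move=> z z0; apply: (law_mono _ _ PF') => //.
    by apply: borel_inter => //; exact: (borel_shift _ z bI).
  by move=> y /=; lra.
have E1 : F (fun y => 0 <= y) = 1.
  rewrite -(law_true _ _ PF') (law_split _ _ PF' _ _ borel_true (borel_lt 0)).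
  rewrite (law_eq _ (fun y => True /\ y < 0) (fun y => y < 0)) ?F0; last by tauto.
  by rewrite Rplus_0_l; apply: law_eq => y; lra.
have E2 : F (fun y => t < y <= x) = 1 - F (fun y => y <= t) - f x.
  have := law_split _ _ PF' _ _ (borel_gt t) bx.
  rewrite (law_eq _ (fun y => t < y /\ ~ y <= x) (ival x None)); last by move=> y /=; lra.
  rewrite -/(f x) -(law_compl _ _ PF') // => E.
  rewrite (law_eq _ (fun y => ~ y <= t) (fun y => t < y)); last by move=> y; lra.
  lra.
rewrite (nonneg_law_le _ _ t PF); move: H2 H3; rewrite E1 E2 (nonneg_law_le _ _ t PF).
lra.
Qed.

(** * Convolution powers as laws *)

Section compound_Poisson_terms.
Variables (F : (R -> Prop) -> R) (T : option R).
Hypothesis HF : distribution_nonneg F.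

Lemma nonneg_law_distribution : exists P, nonneg_law P F.
Proof.
have [P PF] := distribution_probability F HF; exists P; split=> //.
by case: HF => _ [_ []].
Qed.

Lemma nonneg_law_convpow n : exists P, nonneg_law P (convpow F n).
Proof.
have [P PF] := nonneg_law_distribution.
elim: n => [|n [Q QF]]; first exact: nonneg_law_dirac0.
exact: nonneg_law_conv QF PF.
Qed.

Lemma convpow1 A : borel A -> convpow F 1 A = F A.
Proof.
by have [P [PF _]] := nonneg_law_distribution; apply: conv_dirac0 PF.
Qed.

(** [convpow F 1] is known to agree with [F] on Borel sets only, so the two sides are compared
    through the law [P] that they share. *)
Lemma convpow2 A : borel A -> convpow F 2 A = conv F F A.
Proof.
move=> bA; have [P [PF _]] := nonneg_law_distribution.
have PF1 : has_law P (convpow F 1).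
  by move=> B bB; rewrite convpow1 //; exact: PF.
rewrite (conv_joint _ _ _ _ PF PF) //.
exact: (conv_joint _ _ _ _ PF1 PF).
Qed.
End compound_Poisson_terms.

(** * Asymptotics of the convolution powers *)

Definition eventually_at_infinity (p : R -> Prop) := exists x0, forall x, x0 <= x -> p x.

Lemma eventually_and p q : eventually_at_infinity p -> eventually_at_infinity q ->
  eventually_at_infinity (fun x => p x /\ q x).
Proof.
move=> [a pa] [b qb]; exists (Rmax a b) => x abx.
have := Rmax_l a b; have := Rmax_r a b => *.
by split; [apply: pa|apply: qb]; lra.
Qed.

Lemma eventually_imp (p q : R -> Prop) : (forall x, p x -> q x) ->
  eventually_at_infinity p -> eventually_at_infinity q.
Proof. by move=> pq [a pa]; exists a => x /pa/pq. Qed.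

Lemma eventually_ge a : eventually_at_infinity (fun x => a <= x).
Proof. by exists a. Qed.

Lemma eventually_shift p a : eventually_at_infinity p ->
  eventually_at_infinity (fun x => forall y, 0 <= y <= a -> p (x - y)).
Proof. by move=> [x0 px]; exists (x0 + a) => x xx y ya; apply: px; lra. Qed.

Lemma eventually_forall_le (p : nat -> R -> Prop) N :
  (forall n, eventually_at_infinity (p n)) ->
  eventually_at_infinity (fun x => forall n, le n N -> p n x).
Proof.
move=> pn; elim: N => [|N IH].
  by apply: eventually_imp (pn 0%N) => x p0 n /Nat.le_0_r ->.
apply: eventually_imp (eventually_and _ _ IH (pn N.+1)) => x [H1 H2] n.
by move=> /Nat.le_succ_r [/H1|->].
Qed.

Section local_masses.
Variables (F : (R -> Prop) -> R) (T : option R).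
Hypothesis HF : distribution_nonneg F.

Let f x := F (ival x T).
Let fn n x := convpow F n (ival x T).

(** One half of the local uniformity of f(x-y) ~ f(x). The lower bounds rest on it alone, and tails
    have it by monotonicity. *)
Definition lower_regular := forall a d, 0 < d ->
  eventually_at_infinity (fun x => forall y, 0 <= y <= a -> (1 - d) * f x <= f (x - y)).

Definition upper_regular := forall a d, 0 < d ->
  eventually_at_infinity (fun x => forall y, 0 <= y <= a -> f (x - y) <= (1 + d) * f x).

Lemma local_mass_ge0 x : 0 <= f x.
Proof.
have [P [PF _]] := nonneg_law_distribution F HF.
exact: (law_ge0 _ _ PF) (borel_ival x T).
Qed.

Lemma local_massn_ge0 n x : 0 <= fn n x.
Proof.
have [P [PF _]] := nonneg_law_convpow F HF n.
exact: (law_ge0 _ _ PF) (borel_ival x T).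
Qed.

Lemma local_massn_le1 n x : fn n x <= 1.
Proof.
have [P [PF _]] := nonneg_law_convpow F HF n.
exact: (law_le1 _ _ PF) (borel_ival x T).
Qed.

Lemma local_mass0 x : 0 <= x -> fn 0 x = 0.
Proof.
move=> x0; rewrite /fn /= /dirac0 /indic.
by case: excluded_middle_informative => //; case: T => [t|] /=; lra.
Qed.

Lemma convpow_tight n d : 0 < d ->
  exists a, forall b, a <= b -> 1 - d < convpow F n (fun y => y <= b).
Proof.
move=> d0; have [P [PF _]] := nonneg_law_convpow F HF n.
have [a [_ Ha]] := law_tight _ _ PF d d0; exists a => b ab.
apply: Rlt_le_trans Ha _; apply: (law_mono _ _ PF); try exact: borel_le.
by move=> x; lra.
Qed.

Lemma distribution_tight d : 0 < d ->
  exists a, forall b, a <= b -> 1 - d < F (fun y => y <= b).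
Proof.
move=> /(convpow_tight 1) [a Ha]; exists a => b /Ha.
by rewrite convpow1 //; exact: borel_le.
Qed.

Lemma in_L_eventually_pos : in_L F T -> eventually_at_infinity (fun x => 0 < f x).
Proof. by case. Qed.

(** [in_L] controls shifts in [0,1]; induction on N chains them, comparing f(x-y) for y in [N,N+1]
    with f(x-N), and f(x-N) with f(x). *)
Lemma in_L_regular : in_L F T -> forall a d, 0 < d ->
  eventually_at_infinity (fun x => forall y, 0 <= y <= a ->
    (1 - d) * f x <= f (x - y) <= (1 + d) * f x).
Proof.
move=> FL a; have [N aN] := INR_unbounded a.
suff H : forall d, 0 < d -> eventually_at_infinity (fun x => forall y, 0 <= y <= INR N ->
    (1 - d) * f x <= f (x - y) <= (1 + d) * f x).
  by move=> d /H; apply: eventually_imp => x Hx y ya; apply: Hx; lra.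
have pos := in_L_eventually_pos FL; have [_ ratio] := FL.
elim: N {a aN} => [|N IH] d d0.
  apply: eventually_imp pos => x fx y /= y0.
  by rewrite (_ : x - y = x); [nra|lra].
(* Small enough that (1+e)(1-d) <= 1-e and 1+e <= (1-e)(1+d), which absorb one more unit step. *)
pose e := Rmin d 1 / 4.
have dmin := (Rmin_pos d 1 d0 Rlt_0_1, Rmin_l d 1, Rmin_r d 1).
have e0 : 0 < e by rewrite /e; case: dmin => -[]; lra.
have e4 : 4 * e <= d /\ 4 * e <= 1 by rewrite /e; case: dmin => -[]; lra.
have [x0 Hx0] := ratio e e0.
have [x1 Hx1] := pos.
have [x2 Hx2] := IH e e0.
exists (Rmax (Rmax x0 x1) x2 + INR N + 1) => x xx y; rewrite S_INR => yN.
have := Rmax_l (Rmax x0 x1) x2; have := Rmax_r (Rmax x0 x1) x2.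
have := Rmax_l x0 x1; have := Rmax_r x0 x1; have N0 := pos_INR N => *.
have fx : 0 < f x by apply: Hx1; lra.
have [yN'|yN'] := Rle_dec y (INR N).
  by have := Hx2 x _ y (conj (proj1 yN) yN'); nra.
have fN := Hx2 x _ (INR N) (conj N0 (Rle_refl _)).
have {}fN : (1 - e) * f x <= f (x - INR N) <= (1 + e) * f x by apply: fN; lra.
have := Hx0 (x - y) (y - INR N).
rewrite -!/(f _) (_ : x - y + (y - INR N) = x - INR N); last lra.
have fy : 0 < f (x - y) by apply: Hx1; lra.
move=> /(_ _ _)/Rabs_def2 H.
have {}H : - e < f (x - INR N) / f (x - y) - 1 < e by split; apply H; lra.
have E : f (x - INR N) = (f (x - INR N) / f (x - y)) * f (x - y) by field; lra.
set r := f (x - INR N) / f (x - y) in H E.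
have A1 : f (x - INR N) <= (1 + e) * f (x - y).
  by rewrite E; apply: Rmult_le_compat_r; lra.
have A2 : (1 - e) * f (x - y) <= f (x - INR N).
  by rewrite E; apply: Rmult_le_compat_r; lra.
have C1 : (1 + e) * (1 - d) <= 1 - e by nra.
have C2 : 1 + e <= (1 - e) * (1 + d) by nra.
have := Rmult_le_compat_r _ _ _ (Rlt_le _ _ fx) C1.
have := Rmult_le_compat_r _ _ _ (Rlt_le _ _ fx) C2.
by split; [apply: (Rmult_le_reg_l (1 + e))|apply: (Rmult_le_reg_l (1 - e))]; lra.
Qed.

Lemma in_L_lower_regular : in_L F T -> lower_regular.
Proof.
move=> /in_L_regular FL a d d0; apply: eventually_imp (FL a d d0) => x H y ya.
by have [] := H y ya.
Qed.

Lemma in_L_upper_regular : in_L F T -> upper_regular.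
Proof.
move=> /in_L_regular FL a d d0; apply: eventually_imp (FL a d d0) => x H y ya.
by have [] := H y ya.
Qed.

(** For finite T = t, either z <= a + t and f(x-z) is close to f(x), or x - z + t < x - a and the
    event is empty. For infinite T, the truncation alone gives the tail f(x-a). *)
Lemma truncated_mass_le a d : T_pos T -> in_L F T -> 0 <= a -> 0 < d ->
  eventually_at_infinity (fun x => forall z, 0 <= z ->
    F (fun y => ival (x - z) T y /\ x - a < y) <= (1 + d) * f x).
Proof.
move=> Tpos FL a0 d0; have [P [PF _]] := nonneg_law_distribution F HF.
have reg := in_L_upper_regular FL.
have bz x z : borel (fun y => ival (x - z) T y /\ x - a < y).
  by apply: borel_inter; [exact: borel_ival|exact: borel_gt].
have f0 := local_mass_ge0.
move: reg f0 bz Tpos; rewrite /upper_regular /f; case: T => [t|] reg f0 bz Tpos.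
  apply: eventually_imp (reg (a + t) d d0) => x H z z0.
  have [zt|zt] := Rle_dec z (a + t).
    apply: Rle_trans (H z (conj z0 zt)); apply: (law_mono _ _ PF) => //.
      exact: borel_Ioc.
    by move=> y [].
  rewrite (law_eq F _ (fun _ => False)); last by move=> y /=; lra.
  by rewrite (law_empty _ _ PF); have := f0 x; nra.
apply: eventually_imp (reg a d d0) => x H z z0.
have := H a (conj a0 (Rle_refl _)); apply: Rle_trans.
apply: (law_mono _ _ PF) => //; first exact: borel_gt.
by move=> y [].
Qed.

Lemma local_massn_lower n : lower_regular -> forall d, 0 < d ->
  eventually_at_infinity (fun x => (INR n - d) * f x <= fn n x).
Proof.
move=> reg; elim: n => [|n IH] d d0.
  apply: eventually_imp (eventually_ge 0) => x _ /=.
  by have := local_mass_ge0 x; have := local_massn_ge0 0 x; nra.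
have n0 := pos_INR n.
(* (n+1-e)(1-e)^2 equals n+1 - (2n+3)e + e^2 (n+3-e), so this e keeps it at least n+1-d. *)
pose m := 2 * INR n + 3; pose e := Rmin d 1 / m.
have m0 : 3 <= m by rewrite /m; lra.
have em : e * m = Rmin d 1 by rewrite /e; field; lra.
have dmin := (Rmin_pos d 1 d0 Rlt_0_1, Rmin_l d 1, Rmin_r d 1).
have e0 : 0 < e by apply: Rdiv_lt_0_compat; case: dmin => -[]; lra.
have ed : e * m <= d /\ e * m <= 1 by rewrite em; case: dmin => -[]; lra.
have e1 : e < 1 by nra.
have [P PF] := nonneg_law_distribution F HF.
have [Q QF] := nonneg_law_convpow F HF n.
have [a1 Ha1] := distribution_tight e e0; have [a2 Ha2] := convpow_tight n e e0.
pose a := Rmax a1 a2.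
have {}Ha1 : 1 - e < F (fun y => y <= a) by apply: Ha1; exact: Rmax_l.
have {}Ha2 : 1 - e < convpow F n (fun y => y <= a) by apply: Ha2; exact: Rmax_r.
(* [conv_lower] takes nonnegative constants, while n - e is negative for n = 0. *)
pose c := Rmax 0 (INR n - e).
have c0 : 0 <= c by exact: Rmax_l.
have cn : INR n - e <= c by exact: Rmax_r.
apply: eventually_imp (eventually_and _ _ (eventually_ge (2 * a))
  (eventually_and _ _ (reg a e e0) (eventually_shift _ a (IH e e0)))) => x [xa [H1 H2]].
have f0 := local_mass_ge0 x.
have := conv_lower _ _ _ _ PF QF T a x (c * ((1 - e) * f x)) ((1 - e) * f x) xa.
rewrite -/(fn n.+1 x) S_INR => H.
have {}H : c * ((1 - e) * f x) * F (fun y => y <= a) +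
    (1 - e) * f x * convpow F n (fun y => y <= a) <= fn n.+1 x.
  apply: H.
  - by apply: Rmult_le_pos => //; apply: Rmult_le_pos => //; lra.
  - by apply: Rmult_le_pos => //; lra.
  - move=> y ya; have {H1} := H1 y ya; have {H2} := H2 y ya.
    rewrite -/(fn n (x - y)) => H2 H1.
    apply: (Rle_trans _ (c * f (x - y))); first exact: Rmult_le_compat_l.
    apply: (Rmax_case 0 (INR n - e) (fun c => c * f (x - y) <= fn n (x - y))) => //.
    by rewrite Rmult_0_l; exact: local_massn_ge0.
  - exact: H1.
have h0 : 0 <= (1 - e) * f x by apply: Rmult_le_pos => //; lra.
have H3 := Rmult_le_compat_l _ _ _ (Rmult_le_pos _ _ c0 h0) (Rlt_le _ _ Ha1).
have H4 := Rmult_le_compat_l _ _ _ h0 (Rlt_le _ _ Ha2).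
have H5 : (INR n + 1 - d) <= (c + 1) * ((1 - e) * (1 - e)).
  apply: (Rle_trans _ ((INR n - e + 1) * ((1 - e) * (1 - e)))); last first.
    by apply: Rmult_le_compat_r; [nra|lra].
  have : 0 <= e * e * (INR n + 1 + 2 - e) by apply: Rmult_le_pos; nra.
  by rewrite /m in ed; nra.
have := Rmult_le_compat_r _ _ _ f0 H5; lra.
Qed.
End local_masses.

(** * Asymptotic equivalence, and upper bounds under subexponentiality *)

Lemma asymp_equivP (u v : R -> R) : (forall x, 0 <= v x) ->
  asymp_equiv u v <-> forall d, 0 < d -> eventually_at_infinity (fun x =>
    0 < v x /\ (1 - d) * v x <= u x <= (1 + d) * v x).
Proof.
move=> v0; split=> H d d0.
  have [x0 Hx] := H d d0; exists x0 => x /Hx [vn0 /Rabs_def2 uv].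
  have vx : 0 < v x by have := v0 x; lra.
  have E : u x = (u x / v x) * v x by field; lra.
  by rewrite E; split=> //; split; apply: Rmult_le_compat_r; lra.
(* Halving d turns the weak bounds into the strict one of [asymp_equiv]. *)
have [x0 Hx] := H (d / 2) ltac:(lra); exists x0 => x /Hx [vx [H1 H2]].
split; first lra.
have E : u x = (u x / v x) * v x by field; lra.
rewrite E in H1 H2.
have G1 := Rmult_le_reg_r _ _ _ vx H1; have G2 := Rmult_le_reg_r _ _ _ vx H2.
by apply: Rabs_def1; lra.
Qed.

Section subexponential.
Variables (F : (R -> Prop) -> R) (T : option R).
Hypotheses (HF : distribution_nonneg F) (Tpos : T_pos T).

Let f x := F (ival x T).
Let fn n x := convpow F n (ival x T).

Let f0 x : 0 <= f x.
Proof. exact: local_mass_ge0. Qed.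

Let convFF x : conv F F (ival x T) = fn 2 x.
Proof. by rewrite /fn convpow2 //; exact: borel_ival. Qed.

Lemma in_S_conv_upper : in_S F T -> forall d, 0 < d ->
  eventually_at_infinity (fun x => 0 < f x /\ conv F F (ival x T) <= 2 * (1 + d) * f x).
Proof.
move=> [_ [_ H]] d d0.
have v0 x : 0 <= 2 * f x by have := f0 x; lra.
have := (asymp_equivP _ _ v0).1 H d d0.
by apply: eventually_imp => x; rewrite -/(f x) => -[? [? ?]]; lra.
Qed.

Lemma local_massn_upper n : in_S F T -> forall d, 0 < d ->
  eventually_at_infinity (fun x => fn n x <= (INR n + d) * f x).
Proof.
move=> FS; have FL : in_L F T by case: FS => _ [].
elim: n => [|n IH] d d0.
  apply: eventually_imp (eventually_ge 0) => x x0.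
  by rewrite /fn local_mass0 //; have := f0 x; simpl INR; nra.
have n0 := pos_INR n.
(* The recursion below yields (n+e)(1+4e) + 1+e, at most n+1 + (4n+6)e because e <= 1. *)
pose m := 4 * INR n + 6; pose e := Rmin d 1 / m.
have m0 : 6 <= m by rewrite /m; lra.
have em : e * m = Rmin d 1 by rewrite /e; field; lra.
have dmin := (Rmin_pos d 1 d0 Rlt_0_1, Rmin_l d 1, Rmin_r d 1).
have e0 : 0 < e by apply: Rdiv_lt_0_compat; case: dmin => -[]; lra.
have ed : e * m <= d /\ e * m <= 1 by rewrite em; case: dmin => -[]; lra.
have e1 : e < 1 by nra.
have [P PF] := nonneg_law_distribution F HF.
have [Q QF] := nonneg_law_convpow F HF n.
have [a1 Ha1] := distribution_tight F HF e e0; have [a2 Ha2] := IH e e0.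
(* Fixed before x grows: [F] has mass above 1-e up to a, and the induction hypothesis holds beyond
   a. *)
pose a := Rmax 0 (Rmax a1 a2).
have a0 : 0 <= a by exact: Rmax_l.
have aa : Rmax a1 a2 <= a by exact: Rmax_r.
have := Rmax_l a1 a2; have := Rmax_r a1 a2 => aa2 aa1.
have {}Ha1 : 1 - e < F (fun y => y <= a) by apply: Ha1; lra.
have reg := in_L_lower_regular F T FL a e e0.
have trunc := truncated_mass_le F T HF a e Tpos FL a0 e0.
apply: eventually_imp (eventually_and _ _ (in_S_conv_upper FS e e0)
  (eventually_and _ _ reg trunc)) => x [[fx H1] [H2 H3]].
have := conv_upper _ _ _ _ PF QF T a x (INR n + e) ((1 + e) * f x) ((1 - e) * f x).
rewrite -/(fn n.+1 x) S_INR => H.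
have {}H : fn n.+1 x <= (INR n + e) *
    (conv F F (ival x T) - (1 - e) * f x * F (fun y => y <= a)) + (1 + e) * f x.
  apply: H => //; try nra.
  by move=> z az; apply: Ha2; lra.
have h0 : 0 <= (1 - e) * f x by nra.
have H4 := Rmult_le_compat_l _ _ _ h0 (Rlt_le _ _ Ha1).
have H5 : conv F F (ival x T) - (1 - e) * f x * F (fun y => y <= a) <= (1 + 4 * e) * f x.
  have : 0 <= e * e * f x by apply: Rmult_le_pos; nra.
  by lra.
have ne0 : 0 <= INR n + e by lra.
have H6 := Rmult_le_compat_l _ _ _ ne0 H5.
have H7 : (INR n + e) * (1 + 4 * e) + (1 + e) <= INR n + 1 + d.
  by rewrite /m in ed; nra.
have := Rmult_le_compat_r _ _ _ (f0 x) H7; lra.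
Qed.

(** A shift by at most one unit never reduces f below half, so f stays away from 0 on bounded
    ranges. *)
Lemma in_L_bounded_below a : (forall x, a <= x -> 0 < f x) ->
  (forall x t, a <= x -> 0 <= t <= 1 -> Rabs (f (x + t) / f x - 1) < / 2) ->
  forall N x, a <= x <= a + INR N -> (/ 2) ^ N * f a <= f x.
Proof.
move=> pos ratio; elim=> [|N IH] x.
  by move=> /= ax; rewrite (_ : x = a); lra.
rewrite S_INR => ax; pose y := Rmax a (x - 1).
have ya : a <= y by exact: Rmax_l.
have yx : x - 1 <= y by exact: Rmax_r.
have N0 := pos_INR N.
have y1 : y <= x by apply: Rmax_lub; lra.
have yN : y <= a + INR N by apply: Rmax_lub; lra.
have {IH} := IH y (conj ya yN).
have := ratio y (x - y) ya ltac:(lra).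
rewrite (_ : y + (x - y) = x); last lra.
move=> /Rabs_def2 [_ r]; have fy := pos y ya.
have E : f x = (f x / f y) * f y by field; lra.
have : / 2 * f y <= f x by rewrite E; apply: Rmult_le_compat_r; lra.
by simpl pow; lra.
Qed.

(* Only an exponential bound K^n is needed, since the Poisson weights have all
   exponential moments; Kesten's K = 1 + eps is not. *)
Lemma local_massn_exp_bound : in_S F T -> exists K, 1 <= K /\
  eventually_at_infinity (fun x => forall n, fn n x <= K ^ n * f x).
Proof.
move=> FS; have FL : in_L F T by case: FS => _ [].
have [x1 Hx1] := in_L_eventually_pos F T FL.
have [x2 Hx2] := proj2 FL (/ 2) ltac:(lra).
pose a := Rmax 0 (Rmax x1 x2).
have a0 : 0 <= a by exact: Rmax_l.
have aa : Rmax x1 x2 <= a by exact: Rmax_r.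
have := Rmax_l x1 x2; have := Rmax_r x1 x2 => ax2 ax1.
have pos x : a <= x -> 0 < f x by move=> ax; apply: Hx1; lra.
have low := in_L_bounded_below a pos _.
have {}low : forall N x, a <= x <= a + INR N -> (/ 2) ^ N * f a <= f x.
  by apply: low => x t ax t01; apply: Hx2 => //; lra.
have [x3 Hx3] := eventually_and _ _ (in_S_conv_upper FS 1 Rlt_0_1)
   (truncated_mass_le F T HF a 1 Tpos FL a0 Rlt_0_1).
have [N HN] := INR_unbounded (x3 - a).
pose c := (/ 2) ^ N * f a.
have c0 : 0 < c by apply: Rmult_lt_0_compat; [apply: pow_lt; lra|exact: pos (Rle_refl a)].
(* Past [x3] the recursion gives 4 K^n f + 2 f <= 6 K^n f. On [a,x3] one has f >= c, so K f >= 1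
   already exceeds any probability. *)
pose K := 6 + / c.
have ic0 : 0 < / c by exact: Rinv_0_lt_compat.
have K1 : 1 <= K by rewrite /K; lra.
(* The threshold a is the same for all n, so the induction can feed its own hypothesis on all of
   [a,oo) to [conv_upper]. *)
exists K; split=> //; exists a => x ax n.
elim: n x ax => [|n IH] x ax.
  by rewrite /fn local_mass0 /=; [have := f0 x; lra|lra].
have Kn : 1 <= K ^ n by exact: pow_R1_Rle.
have fx := pos x ax.
have [xx3|xx3] := Rle_dec x3 x; last first.
  have fc : c <= f x by apply: low; lra.
  apply: Rle_trans (local_massn_le1 F T HF n.+1 x) _.
  have Kf : 1 <= K * f x.
    apply: (Rle_trans _ (/ c * f x)).
      by rewrite -(Rinv_l c); [apply: Rmult_le_compat_l|]; lra.
    by apply: Rmult_le_compat_r; rewrite /K; lra.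
  have := Rmult_le_compat_l (K ^ n) _ _ ltac:(lra) Kf; simpl pow; lra.
have [[_ H1] H2] := Hx3 x xx3.
have [P PF] := nonneg_law_distribution F HF.
have [Q QF] := nonneg_law_convpow F HF n.
have := conv_upper _ _ _ _ PF QF T a x (K ^ n) ((1 + 1) * f x) 0.
rewrite -/(fn n.+1 x) => H.
have {}H : fn n.+1 x <= K ^ n * (conv F F (ival x T) - 0 * F (fun y => y <= a)) +
    (1 + 1) * f x.
  by apply: H => //; try lra; move=> y _; exact: f0.
have := Rmult_le_compat_l (K ^ n) _ _ ltac:(lra) H1.
have := Rmult_le_compat_r (f x) _ _ ltac:(lra) Kn.
have : 6 * (K ^ n * f x) <= K * (K ^ n * f x).
  by apply: Rmult_le_compat_r; [nra|rewrite /K; lra].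
simpl pow; lra.
Qed.

Lemma lower_regular_conv d : lower_regular F T -> 0 < d ->
  eventually_at_infinity (fun x => (2 - d) * f x <= conv F F (ival x T)).
Proof.
move=> reg d0; have := local_massn_lower F T HF 2 reg d d0.
by apply: eventually_imp => x; rewrite convFF /fn; simpl INR; rewrite -/(f x); lra.
Qed.
End subexponential.

(** * The case of infinite T: monotone tails *)

Section tails.
Variable F : (R -> Prop) -> R.
Hypothesis HF : distribution_nonneg F.

Let f x := F (ival x None).

Lemma tail_antitone x y : x <= y -> f y <= f x.
Proof.
have [P [PF _]] := nonneg_law_distribution F HF.
by move=> xy; apply: (law_mono _ _ PF); try exact: borel_gt; move=> z /=; lra.
Qed.

Lemma tail_compl x : f x = 1 - F (fun y => y <= x).
Proof.
have [P [PF _]] := nonneg_law_distribution F HF.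
rewrite -(law_compl _ _ PF); last exact: borel_le.
by apply: law_eq => y /=; lra.
Qed.

Lemma tail_lower_regular : lower_regular F None.
Proof.
move=> a d d0; exists 0 => x _ y y0.
have f0 : 0 <= f x by exact: local_mass_ge0.
have : f x <= f (x - y) by apply: tail_antitone; lra.
rewrite -/(f x) -/(f (x - y)); nra.
Qed.

Lemma eventually_pos_unbounded T :
  eventually_at_infinity (fun x => 0 < F (ival x T)) -> unbounded_support F.
Proof.
have [P [PF _]] := nonneg_law_distribution F HF.
move=> [x0 Hx] a; have aM := Rmax_l a x0; have := Hx _ (Rmax_r a x0).
move=> /Rlt_le_trans; apply; apply: (law_mono _ _ PF).
- exact: borel_ival.
- exact: borel_gt.
- by move=> y; case: T {Hx} => [t|] /=; lra.
Qed.

(** With t = 1 and c = f(1), [conv_tail_lower] and the bound on [conv F F] give f(x-1)(c - f(x)) <=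
    f(x)(c + 2ec). Since f(x) tends to 0 and c > 0, f(x-1) is at most (1+o(1)) f(x); monotonicity
    does the rest. *)
Lemma tail_in_L : unbounded_support F ->
  (forall d, 0 < d -> eventually_at_infinity (fun x =>
    conv F F (ival x None) <= 2 * (1 + d) * f x)) ->
  in_L F None.
Proof.
move=> unb conv2; have [P PF] := nonneg_law_distribution F HF.
have pos x : 0 < f x by exact: unb.
split; first by exists 0 => x _; exact: pos.
move=> eps eps0.
pose c := f 1; have c0 : 0 < c by exact: pos.
have c1 : F (fun y => y <= 1) = 1 - c by rewrite /c tail_compl; lra.
pose e := Rmin eps 1 / 8.
have dmin := (Rmin_pos eps 1 eps0 Rlt_0_1, Rmin_l eps 1, Rmin_r eps 1).
have e0 : 0 < e by rewrite /e; case: dmin => -[]; lra.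
have e8 : 8 * e <= eps /\ 8 * e <= 1 by rewrite /e; case: dmin => -[]; lra.
have ec0 : 0 < e * c by nra.
have [a Ha] := distribution_tight F HF (e * c) ec0.
have [b Hb] := conv2 (e * c) ec0.
have step x : Rmax (Rmax a b) 1 <= x -> (1 - 4 * e) * f (x - 1) <= f x.
  move=> xx; have := Rmax_l (Rmax a b) 1; have := Rmax_r (Rmax a b) 1.
  have := Rmax_l a b; have := Rmax_r a b => *.
  have H1 : f x + f x * (1 - c) + f (x - 1) * (1 - (1 - c) - f x) <=
      conv F F (ival x None).
    by rewrite -c1; apply: (conv_tail_lower P F 1 x PF); lra.
  have H2 : conv F F (ival x None) <= 2 * (1 + e * c) * f x by apply: Hb; lra.
  have H3 : f x <= e * c by rewrite tail_compl; have := Ha x ltac:(lra); lra.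
  have H4 : f (x - 1) * (c - f x) <= f x * (c + 2 * (e * c)) by lra.
  have H5 : f (x - 1) * (c - e * c) <= f (x - 1) * (c - f x).
    by apply: Rmult_le_compat_l; [exact: Rlt_le|lra].
  have H6 : (1 - e) * f (x - 1) <= (1 + 2 * e) * f x.
    by apply: (Rmult_le_reg_l c) => //; lra.
  have H7 : (1 + 2 * e) * (1 - 4 * e) <= 1 - e by nra.
  have := Rmult_le_compat_r _ _ _ (Rlt_le _ _ (pos (x - 1))) H7.
  by move=> H8; apply: (Rmult_le_reg_l (1 + 2 * e)); lra.
exists (Rmax (Rmax a b) 1) => x t xx t01.
rewrite -/(f x) -/(f (x + t)).
have := step (x + 1) ltac:(lra); rewrite (_ : x + 1 - 1 = x); last lra.
move=> H1; have H2 : f (x + 1) <= f (x + t) by apply: tail_antitone; lra.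
have H3 : f (x + t) <= f x by apply: tail_antitone; lra.
have px := pos x.
have E : f (x + t) = (f (x + t) / f x) * f x by field; lra.
have G1 : (1 - 4 * e) <= f (x + t) / f x.
  by apply: (Rmult_le_reg_r (f x)) => //; lra.
have G2 : f (x + t) / f x <= 1.
  by apply: (Rmult_le_reg_r (f x)) => //; lra.
by apply: Rabs_def1; lra.
Qed.
End tails.

(** * Poisson mixtures *)

(** Spelled as the weight in [cpoisson], so that the compound law unfolds to a series in these
    weights by conversion. *)
Definition poisson (mu : R) (n : nat) := exp (- mu) * (mu ^ n / INR (Factorial.fact n)).

Lemma poisson_gt0 mu n : 0 < mu -> 0 < poisson mu n.
Proof.
move=> mu0; apply: Rmult_lt_0_compat; first exact: exp_pos.
by apply: Rdiv_lt_0_compat; [exact: pow_lt|exact: INR_fact_lt_0].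
Qed.

(** The exponential series at mu K; its tails dominate the remainder of the mixture. *)
Lemma poisson_exp_moment mu K :
  Un_cv (sum_f_R0 (fun n => poisson mu n * K ^ n)) (exp (- mu) * exp (mu * K)).
Proof.
have E : Un_cv (sum_f_R0 (fun i => / INR (Factorial.fact i) * (mu * K) ^ i)) (exp (mu * K)).
  exact: (proj2_sig (exist_exp (mu * K))).
apply: (Un_cv_ext (fun N => exp (- mu) *
    sum_f_R0 (fun i => / INR (Factorial.fact i) * (mu * K) ^ i) N)).
  move=> N; rewrite scal_sum; apply: PartSum.sum_eq => i _.
  by rewrite /poisson Rpow_mult_distr /Rdiv; ring.
by apply: CV_mult => // e e0; exists 0%N => n _; rewrite Rdist_eq.
Qed.

Lemma poisson_total mu : Un_cv (sum_f_R0 (poisson mu)) 1.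
Proof.
have -> : 1 = exp (- mu) * exp (mu * 1).
  by rewrite -exp_plus Rmult_1_r Rplus_opp_l exp_0.
apply: Un_cv_ext (poisson_exp_moment mu 1) => N.
by apply: PartSum.sum_eq => i _; rewrite pow1; ring.
Qed.

(** The identity (n+1) p_{n+1} = mu p_n shifts the index by one, and the term n = 0 vanishes. *)
Lemma poisson_partial_mean mu N :
  sum_f_R0 (fun n => INR n * poisson mu n) N.+1 = mu * sum_f_R0 (poisson mu) N.
Proof.
have step n : INR n.+1 * poisson mu n.+1 = mu * poisson mu n.
  rewrite /poisson fact_simpl mult_INR -tech_pow_Rmult; field.
  by split; [exact: INR_fact_neq_0|apply: not_0_INR].
elim: N => [|N IH].
  by rewrite [LHS]/= -/(poisson mu 1); have := step 0%N; rewrite /=; lra.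
rewrite tech5 IH step; simpl sum_f_R0; ring.
Qed.

Lemma poisson_mean mu : Un_cv (sum_f_R0 (fun n => INR n * poisson mu n)) mu.
Proof.
move=> e e0; have : Un_cv (fun N => mu * sum_f_R0 (poisson mu) N) mu.
  rewrite -[X in Un_cv _ X]Rmult_1_r; apply: CV_mult; last exact: poisson_total.
  by move=> d d0; exists 0%N => n _; rewrite Rdist_eq.
move=> /(_ e e0) [N HN]; exists N.+1 => -[|n] nN; first lia.
by rewrite poisson_partial_mean; apply: HN; lia.
Qed.

Lemma series_sum_eq a l : Un_cv (sum_f_R0 a) l -> series_sum a = l.
Proof.
move=> al; rewrite /series_sum; case: excluded_middle_informative => [H|[]].
  case: (ClassicalEpsilon.constructive_indefinite_description _ H) => m /= am.
  exact: UL_sequence am al.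
by exists l.
Qed.

Lemma Un_cv_upper_bound u l b N :
  Un_cv u l -> (forall n, le N n -> u n <= b) -> l <= b.
Proof.
move=> ul ub; apply: le_epsilon => e e0; have [M HM] := ul e e0.
have := HM (N + M)%coq_nat ltac:(lia); have := ub (N + M)%coq_nat ltac:(lia).
by rewrite /Rdist => ? /Rabs_def2; lra.
Qed.

Section poisson_mixture.
Variables (mu : R) (g : nat -> R) (y : R).
Hypotheses (mu0 : 0 < mu) (g0 : forall n, 0 <= g n).

Let p := poisson mu.

Lemma poisson_partial_upper d N :
  (forall n, le n N -> g n <= (INR n + d) * y) ->
  sum_f_R0 (fun n => p n * g n) N <=
    (sum_f_R0 (fun n => INR n * p n) N + d * sum_f_R0 p N) * y.
Proof.
elim: N => [|N IH] gU.
  have := Rmult_le_compat_l (p 0%N) _ _ (Rlt_le _ _ (poisson_gt0 mu 0 mu0)) (gU 0%N (le_n 0)).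
  by rewrite /sum_f_R0; lra.
rewrite !tech5; have {}IH := IH (fun n nN => gU n (le_S _ _ nN)).
have := Rmult_le_compat_l (p N.+1) _ _ (Rlt_le _ _ (poisson_gt0 mu N.+1 mu0))
  (gU N.+1 (le_n _)).
lra.
Qed.

(** The slack r is zero when G is bounded below, and sits at n = 2 alone when f_2 has to be
    isolated. *)
Lemma poisson_partial_lower d r N :
  (forall n, le n N -> (INR n - d) * y + r n <= g n) ->
  (sum_f_R0 (fun n => INR n * p n) N - d * sum_f_R0 p N) * y +
    sum_f_R0 (fun n => p n * r n) N <= sum_f_R0 (fun n => p n * g n) N.
Proof.
elim: N => [|N IH] gL.
  have := Rmult_le_compat_l (p 0%N) _ _ (Rlt_le _ _ (poisson_gt0 mu 0 mu0)) (gL 0%N (le_n 0)).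
  by rewrite /sum_f_R0; lra.
rewrite !tech5; have {}IH := IH (fun n nN => gL n (le_S _ _ nN)).
have := Rmult_le_compat_l (p N.+1) _ _ (Rlt_le _ _ (poisson_gt0 mu N.+1 mu0))
  (gL N.+1 (le_n _)).
lra.
Qed.

Lemma poisson_total_le1 N : sum_f_R0 p N <= 1.
Proof.
apply: sum_incr (poisson_total mu) _ => n.
exact: Rlt_le (poisson_gt0 mu n mu0).
Qed.

Hypothesis g1 : forall n, g n <= 1.

Lemma poisson_mixture_cv :
  Un_cv (sum_f_R0 (fun n => p n * g n)) (series_sum (fun n => p n * g n)).
Proof.
have [l gl] : {l | Un_cv (sum_f_R0 (fun n => p n * g n)) l}.
  apply: (Rseries_CV_comp _ p); last by exists 1; exact: poisson_total.
  move=> n; have pn := Rlt_le _ _ (poisson_gt0 mu n mu0).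
  split; first exact: Rmult_le_pos.
  by rewrite -{2}(Rmult_1_r (p n)); exact: Rmult_le_compat_l.
by rewrite (series_sum_eq _ _ gl).
Qed.

Lemma poisson_mixture_ge N :
  sum_f_R0 (fun n => p n * g n) N <= series_sum (fun n => p n * g n).
Proof.
apply: sum_incr poisson_mixture_cv _ => n.
by apply: Rmult_le_pos => //; exact: Rlt_le (poisson_gt0 mu n mu0).
Qed.

(** Dominated convergence in explicit form: the terms beyond N are at most y times those of the
    series of p_n K^n. *)
Lemma poisson_mixture_le K N d : 0 <= y -> (forall n, g n <= K ^ n * y) ->
  (forall M, le N M -> sum_f_R0 (fun n => p n * K ^ n) M <=
                       sum_f_R0 (fun n => p n * K ^ n) N + d) ->
  series_sum (fun n => p n * g n) <= sum_f_R0 (fun n => p n * g n) N + d * y.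
Proof.
move=> y0 gK tail; apply: (Un_cv_upper_bound _ _ _ N poisson_mixture_cv) => M NM.
have : sum_f_R0 (fun n => p n * g n) M - sum_f_R0 (fun n => p n * g n) N <=
    (sum_f_R0 (fun n => p n * K ^ n) M - sum_f_R0 (fun n => p n * K ^ n) N) * y.
  elim: M NM {tail} => [|M IH] NM.
    by have -> : N = 0%N by [lia]; lra.
  have [->|{}NM] : N = M.+1 \/ le N M by lia.
    by lra.
  rewrite !tech5; have {}IH := IH NM.
  have := Rmult_le_compat_l (p M.+1) _ _ (Rlt_le _ _ (poisson_gt0 mu M.+1 mu0)) (gK M.+1).
  lra.
have := Rmult_le_compat_r _ _ _ y0 (tail M NM); lra.
Qed.
End poisson_mixture.

Lemma sum_single2 (c : R) (p : nat -> R) N : le 2 N ->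
  sum_f_R0 (fun n => p n * (if Nat.eqb n 2 then c else 0)) N = p 2%N * c.
Proof.
elim: N => [|N IH] N2; first lia.
rewrite tech5; have [->|{}N2] : N = 1%N \/ le 2 N by lia.
  by simpl; ring.
by rewrite IH // (_ : Nat.eqb N.+1 2 = false); [ring|apply/Nat.eqb_neq; lia].
Qed.

(** * Subexponentiality and the compound Poisson asymptotics *)

Theorem theorem6 (F : (R -> Prop) -> R) (mu : R) (T : option R) :
  distribution_nonneg F -> 0 < mu -> T_pos T ->
  (match T with Some _ => in_L F T | None => True end) ->
  (in_S F T <->
   asymp_equiv (fun x => cpoisson mu F (ival x T)) (fun x => mu * F (ival x T))).
Proof.
move=> HF mu0 Tpos HT.
pose f x := F (ival x T); pose fn n x := convpow F n (ival x T).
have f0 x : 0 <= f x := local_mass_ge0 F T HF x.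
have fn0 x n : 0 <= fn n x := local_massn_ge0 F T HF n x.
have fn1 x n : fn n x <= 1 := local_massn_le1 F T HF n x.
have GE x : cpoisson mu F (ival x T) = series_sum (fun n => poisson mu n * fn n x) by [].
have v0 x : 0 <= mu * f x by apply: Rmult_le_pos => //; lra.
have mean d : 0 < d -> exists N0, forall N, le N0 N ->
    Rabs (sum_f_R0 (fun n => INR n * poisson mu n) N - mu) < d.
  by move=> d0; have [N0 HN] := poisson_mean mu d d0; exists N0 => N NN; apply: HN.
have low : lower_regular F T.
  case: T HT {Tpos f fn f0 fn0 fn1 GE v0} => [t|] HT; last exact: tail_lower_regular.
  exact: in_L_lower_regular.
have posS : eventually_at_infinity (fun x => 0 < f x) -> unbounded_support F.
  exact: eventually_pos_unbounded.
rewrite (asymp_equivP _ _ v0); split=> [FS d d0|H].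
- have FL : in_L F T by case: FS => _ [].
  have [K [K1 HK]] := local_massn_exp_bound F T HF Tpos FS.
  (* Three errors of size e: truncating the mean, the deviation of f_n from n f for n <= N, and the
     terms beyond N. *)
  pose e := d * mu / 3; have e0 : 0 < e by apply: Rdiv_lt_0_compat; nra.
  have [N1 HN1] := mean e e0.
  (* Two partial sums within e/2 of the limit differ by less than e. *)
  have [N2 HN2] := poisson_exp_moment mu K (e / 2) ltac:(lra).
  pose N := Nat.max N1 N2.
  have := eventually_forall_le _ N (fun n => local_massn_lower F T HF n low e e0).
  have := eventually_forall_le _ N (fun n => local_massn_upper F T HF Tpos n FS e e0).
  move=> evU evL.
  apply: eventually_imp (eventually_and _ _ (in_L_eventually_pos F T FL)
    (eventually_and _ _ HK (eventually_and _ _ evU evL))) => x.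
  rewrite -/(f x) => -[fx [Kx [Ux Lx]]]; split; first by apply: Rmult_lt_0_compat.
  have /Rabs_def2 [M1 M2] := HN1 N (Nat.le_max_l _ _).
  have T1 := poisson_total_le1 mu mu0 N.
  have eT : e * sum_f_R0 (poisson mu) N <= e * 1 by apply: Rmult_le_compat_l; lra.
  have e3 : 3 * e = d * mu by rewrite /e; field.
  rewrite GE; split.
  + have H1 := poisson_partial_lower mu (fn^~ x) (f x) mu0 e (fun=> 0) N.
    rewrite (PartSum.sum_eq_R0 (fun n => poisson mu n * 0)) in H1; last by move=> n _; ring.
    have {}H1 := H1 (fun n nN => Rle_trans _ _ _ (Req_le _ _ (Rplus_0_r _)) (Lx n nN)).
    have H2 := poisson_mixture_ge mu (fn^~ x) mu0 (fn0 x) (fn1 x) N.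
    have H3 : (1 - d) * mu <= sum_f_R0 (fun n => INR n * poisson mu n) N -
        e * sum_f_R0 (poisson mu) N by lra.
    have := Rmult_le_compat_r _ _ _ (f0 x) H3; lra.
  + have H1 := poisson_partial_upper mu (fn^~ x) (f x) mu0 e N Ux.
    have H2 : series_sum (fun n => poisson mu n * fn n x) <=
        sum_f_R0 (fun n => poisson mu n * fn n x) N + e * f x.
      apply: (poisson_mixture_le mu (fn^~ x) (f x) mu0 (fn0 x) (fn1 x) K) => // M NM.
      have := HN2 N (Nat.le_max_r _ _); have := HN2 M ltac:(lia).
      by move=> /Rabs_def2 ? /Rabs_def2 ?; lra.
    have H3 : sum_f_R0 (fun n => INR n * poisson mu n) N +
        e * sum_f_R0 (poisson mu) N + e <= (1 + d) * mu by lra.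
    have := Rmult_le_compat_r _ _ _ (f0 x) H3; lra.
- have evpos : eventually_at_infinity (fun x => 0 < f x).
    apply: eventually_imp (H 1 Rlt_0_1) => x [mf _].
    by apply: (Rmult_lt_reg_l mu) => //; rewrite Rmult_0_r.
  have unb := posS evpos.
  have conv2 d : 0 < d -> eventually_at_infinity (fun x =>
      conv F F (ival x T) <= 2 * (1 + d) * f x).
    move=> d0; have p2 := poisson_gt0 mu 2 mu0.
    (* G is at most (1+e) mu f and the lower bounds sum to at least (mu - 2e) f. The gap e (mu+2) f
       bounds p_2 (f_2 - 2f), and must equal 2 d p_2 f. *)
    pose e := 2 * d * poisson mu 2 / (mu + 2).
    have e0 : 0 < e by apply: Rdiv_lt_0_compat; nra.
    have ed : e * (mu + 2) = 2 * d * poisson mu 2 by rewrite /e; field; lra.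
    have [N0 HN0] := mean e e0; pose N := Nat.max N0 2.
    have /Rabs_def2 [_ M2] := HN0 N (Nat.le_max_l _ _).
    have T1 := poisson_total_le1 mu mu0 N.
    have eT : e * sum_f_R0 (poisson mu) N <= e * 1 by apply: Rmult_le_compat_l; lra.
    have evL := eventually_forall_le _ N (fun n => local_massn_lower F T HF n low e e0).
    apply: eventually_imp (eventually_and _ _ (H e e0) evL) => x [[_ [_ GU]] Lx].
    have -> : conv F F (ival x T) = fn 2%N x.
      by rewrite /fn convpow2 //; exact: borel_ival.
    (* All terms keep their lower bound (n-e) f, except that n = 2 also carries the excess f_2 -
       2f. *)
    have H1 : (sum_f_R0 (fun n => INR n * poisson mu n) N - e * sum_f_R0 (poisson mu) N)
        * f x + sum_f_R0 (fun n => poisson mu n *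
          (if Nat.eqb n 2 then fn 2%N x - 2 * f x else 0)) N <=
        sum_f_R0 (fun n => poisson mu n * fn n x) N.
      apply: (poisson_partial_lower mu (fn^~ x)) => // n nN.
      case E : (Nat.eqb n 2); last by rewrite Rplus_0_r; exact: Lx.
      move/Nat.eqb_eq: E => ->; have := Rmult_le_pos _ _ (Rlt_le _ _ e0) (f0 x).
      by simpl INR; lra.
    rewrite sum_single2 in H1; last exact: Nat.le_max_r.
    have H2 := poisson_mixture_ge mu (fn^~ x) mu0 (fn0 x) (fn1 x) N.
    rewrite GE -/(f x) in GU.
    have H3 : mu - 2 * e <= sum_f_R0 (fun n => INR n * poisson mu n) N -
        e * sum_f_R0 (poisson mu) N by lra.
    have H4 := Rmult_le_compat_r _ _ _ (f0 x) H3.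
    have H5 : poisson mu 2 * (fn 2%N x - 2 * f x) <= e * (mu + 2) * f x by lra.
    by rewrite ed in H5; apply: (Rmult_le_reg_l (poisson mu 2)) => //; lra.
  (* Assumed when T is finite; for infinite T it is recovered from the bound on [conv F F]. *)
  have FL : in_L F T.
    move: HT conv2; rewrite /f; case: (T) => [t|] // _ conv2.
    exact: tail_in_L.
  split=> //; split=> //.
  have w0 x : 0 <= 2 * F (ival x T) by have := f0 x; rewrite /f; lra.
  apply/(asymp_equivP _ _ w0) => d d0.
  (* The lower bound (2-2d) f is (1-d) times the comparison function 2f. *)
  have d20 : 0 < 2 * d by lra.
  apply: eventually_imp (eventually_and _ _ evpos (eventually_and _ _ (conv2 d d0)
    (lower_regular_conv F T HF (2 * d) low d20))) => x.
  by rewrite -/(f x) => -[? [? ?]]; lra.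
Qed.
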